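(* The prime divisors $\mathfrak m$ of $\Delta$ in $S$ are in one-one correspondence with the classes of isomorphism pairs $\mu,\mu'$ of $K,K'$ into an algebraic function field of one variable, in such a way that the residue class homomorphism of $\Delta$ modulo $\mathfrak m$ induces the isomorphism pair $\mu,\mu'$ and that $$\Delta\mathfrak m=K\mu\cdot K'\mu'.$$
   Context: Setting. $k$ is a number field. $K$ and $K'$ are algebraic function fields of one variable over $k$: finite extensions of $k(x)$ and $k(x')$, respectively, with $x,x'$ algebraically independent over $k$. The double field of $K$ and $K'$ is $\Delta=k(x,x';u,u')$ with $f(x,u)=0$ and $f'(x',u')=0$, where $f,f'$ are generating irreducible polynomials of $K=k(x,u)$ and $K'=k(x',u')$ over $k$. $S$ is the set of prime divisors $\mathfrak m$ of $\Delta$, i.e. normalized (discrete, nontrivial) valuations $w_{\mathfrak m}$ of $\Delta$ up to equivalence, of the following kinds: binary ($w_{\mathfrak m}$ is identically zero on both $K$ and $K'$), $K$-unary ($w_{\mathfrak m}$ is identically zero on $K'$ but not on $K$), and $K'$-unary ($w_{\mathfrak m}$ is identically zero on $K$ but not on $K'$). Maps are written on the right. $\Delta\mathfrak m$ is the residue field of $\Delta$ modulo $\mathfrak m$, and $a\mapsto a\mathfrak m$ is the residue class homomorphism ($a\mathfrak m=\infty$ if $a$ is not integral for $\mathfrak m$). Isomorphism pairs. An isomorphism pair $\mu,\mu'$ of $K,K'$ consists of isomorphisms (over $k$) of $K$ and $K'$ into an algebraic function field of one variable. One of the two, but not both, is allowed to degenerate to a homomorphism; if, say, $\mu$ degenerates,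 then $\mu$ is the residue class homomorphism of $K$ modulo a prime divisor of $K$ (with value $\infty$ on non-integral elements), and $K\mu$ is the residue field, a finite extension of $k$. $K\mu\cdot K'\mu'$ is the field composite. Two pairs $(\mu,\mu')$ and $(\mu_1,\mu_1')$ are in the same class if there is an isomorphism $\sigma$ of $K\mu\cdot K'\mu'$ onto $K\mu_1\cdot K'\mu_1'$ with $\mu_1=\mu\sigma$ and $\mu_1'=\mu'\sigma$.
   Formalization: The formal double field also requires f' to stay irreducible over K(x'), i.e. K and K' linearly disjoint over k (automatic if k is algebraically closed in K or K'); otherwise Δ is not determined by f, f', and some isomorphism pairs come from no prime divisor. *)

(* Defs.v *)
From HB Require Import structures.
From mathcomp Require Import all_boot all_order all_algebra all_field.
From mathcomp Require Import generic_quotient ring_quotient.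

Set Implicit Arguments.
Unset Strict Implicit.
Unset Printing Implicit Defensive.

Import Order.TTheory GRing.Theory Num.Theory.
Local Open Scope ring_scope.
Local Open Scope quotient_scope.

(* Normalized discrete valuation.  Only the values on nonzero elements are
   meaningful: v(0) is [+oo] mathematically and [val 0] is a junk value, so that
   every statement about [val] is guarded by nonzeroness. *)
Record valuation (L : fieldType) := Valuation {
  val_of :> L -> int;
  valuationM : forall a b, a != 0 -> b != 0 ->
    val_of (a * b) = val_of a + val_of b;
  valuationD : forall a b, a != 0 -> b != 0 -> a + b != 0 ->
    Num.min (val_of a) (val_of b) <= val_of (a + b);
  valuation_normalized : exists2 a, a != 0 & val_of a = 1 }.

(* Equivalent normalized valuations are equal on L^*. *)
Definition eqv_valuation (L : fieldType) (v w : valuation L) : Prop :=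
  forall a, a != 0 -> v a = w a.

Definition trivial_on (E L : fieldType) (j : E -> L) (v : valuation L) : Prop :=
  forall a, a != 0 -> v (j a) = 0.

Definition val_ring (L : fieldType) (v : valuation L) : {pred L} :=
  [pred a | (a == 0) || (0 <= v a)].

Section ValuationRing.

Variables (L : fieldType) (v : valuation L).

Lemma valuation1 : v 1 = 0.
Proof.
have := valuationM v (oner_neq0 L) (oner_neq0 L).
by rewrite mulr1 -[LHS]addr0 => /addrI.
Qed.

Lemma valuationN a : a != 0 -> v (- a) = v a.
Proof.
have n1 : -1 != 0 :> L by rewrite oppr_eq0 oner_neq0.
have vn1 : v (-1) = 0.
  have := valuationM v n1 n1; rewrite mulrNN mulr1 valuation1 => /esym/eqP.
  by rewrite -mulr2n mulrn_eq0 => /eqP.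
by move=> a0; rewrite -mulN1r valuationM // vn1 add0r.
Qed.

Lemma valuationV a : a != 0 -> v a^-1 = - v a.
Proof.
move=> a0; apply/eqP; rewrite -addr_eq0 -valuationM ?invr_eq0 //.
by rewrite mulVf // valuation1.
Qed.

(* The common pattern behind the valuation ring (c = 0) and its maximal
   ideal (c = 1). *)
Lemma val_ge_closedB c a b :
  (a == 0) || (c <= v a) -> (b == 0) || (c <= v b) ->
  (a - b == 0) || (c <= v (a - b)).
Proof.
have [->|a0] /= := eqVneq a 0.
  by rewrite sub0r oppr_eq0; have [//|b0] := eqVneq b 0; rewrite valuationN.
have [->|b0] /= := eqVneq b 0; first by rewrite subr0 orbC => ->.
move=> ha hb; have [//|ab0] /= := eqVneq (a - b) 0.
have nb0 : - b != 0 by rewrite oppr_eq0.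
apply: le_trans _ (valuationD v a0 nb0 ab0).
by rewrite valuationN // le_min ha hb.
Qed.

Lemma val_ring_subring : subring_closed (val_ring v).
Proof.
split=> [|a b|a b]; rewrite !inE.
- by rewrite valuation1 lexx orbT.
- exact: val_ge_closedB.
have [->|a0] /= := eqVneq a 0; first by rewrite mul0r eqxx.
have [->|b0] /= := eqVneq b 0; first by rewrite mulr0 eqxx.
by move=> ha hb; rewrite valuationM // addr_ge0 ?orbT.
Qed.

HB.instance Definition _ :=
  GRing.isSubringClosed.Build L (val_ring v) val_ring_subring.

Record val_ring_type := ValRing {
  val_ring_val :> L;
  val_ringP : val_ring_val \in val_ring v }.

HB.instance Definition _ := [isSub for val_ring_val].
HB.instance Definition _ := [Choice of val_ring_type by <:].
HB.instance Definition _ :=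
  [SubChoice_isSubComNzRing of val_ring_type by <:].

Definition max_ideal : {pred val_ring_type} :=
  [pred a : val_ring_type | (a == 0 :> L) || (1 <= v a)].

Lemma max_ideal_closed : idealr_closed max_ideal.
Proof.
split=> [||a b c]; rewrite !inE.
- by rewrite (eqxx (0 : L)).
- by rewrite (negPf (oner_neq0 L)) valuation1.
have -> : val_ring_val (a * b + c) =
    val_ring_val a * val_ring_val b - (- val_ring_val c).
  by rewrite opprK.
case: a b c => [a ha] [b hb] [c hc] /= {hb hc} hb hc; rewrite inE in ha.
apply: val_ge_closedB; last first.
  by rewrite oppr_eq0; have [//|c0] := eqVneq c 0; rewrite valuationN // orFb;
     move: hc; rewrite (negPf c0).
have [->|a0] := eqVneq a 0; first by rewrite mul0r eqxx.
have [->|b0] := eqVneq b 0; first by rewrite mulr0 eqxx.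
move: ha hb; rewrite (negPf a0) (negPf b0) /= => ha hb.
by rewrite valuationM // ler_wpDl ?orbT.
Qed.

HB.instance Definition _ :=
  isIdealr.Build val_ring_type max_ideal max_ideal_closed.

Definition residue_field : Type := {ideal_quot max_ideal}.

HB.instance Definition _ := GRing.ComNzRing.on residue_field.

Definition residue_inv (x : residue_field) : residue_field :=
  if x == 0 then 0
  else \pi_{ideal_quot max_ideal} (insubd 0 (val_ring_val (repr x))^-1).

Lemma residue_mulVf x : x != 0 -> residue_inv x * x = 1.
Proof.
rewrite /residue_inv => nx0; rewrite (negPf nx0).
elim/quotW: x nx0 => y; set r := repr _.
have <- : \pi_{ideal_quot max_ideal} r = \pi y by rewrite reprK.
move=> nr0.
have rI : r \notin max_ideal.
  apply: contraNN nr0 => rI; apply/eqP.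
  have <- : \pi_{ideal_quot max_ideal} 0 = 0 by exact: pi_zeror.
  by apply/eqmodP; rewrite /= Quotient.equivE subr0.
rewrite -pi_mulr.
suff -> : insubd (0 : val_ring_type) (val_ring_val r)^-1 * r = 1.
  exact: pi_oner.
case: r rI {nr0} => r rP; rewrite !inE /= negb_or -ltNge => /andP[r0 vr1].
have vr : v r = 0.
  move: (rP); rewrite inE (negPf r0) /= => vr0; apply/eqP.
  by rewrite eq_le vr0 andbT -ltzD1 add0r.
apply: val_inj => /=.
change (val_ring_val (insubd 0 r^-1) * r = 1).
rewrite [X in X * _](@insubdK _ _ val_ring_type) ?mulVf //.
by rewrite !inE valuationV // vr oppr0 lexx orbT.
Qed.

Lemma residue_inv0 : residue_inv 0 = 0.
Proof. by rewrite /residue_inv eqxx. Qed.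

HB.instance Definition _ :=
  GRing.ComNzRing_isField.Build residue_field residue_mulVf residue_inv0.

End ValuationRing.

Arguments max_ideal {L} v _.

(* The residue class homomorphism; [None] stands for the value oo taken at
   non-integral elements. *)
Definition residue_class (L : fieldType) (v : valuation L) (a : L) :
    option (residue_field v) :=
  omap \pi_{ideal_quot (max_ideal v)} (insub a).

Definition generated (L : fieldType) (A : L -> Prop) (b : L) : Prop :=
  forall P : {pred L}, divring_closed P -> (forall a, A a -> a \in P) -> b \in P.

Definition adjoin (k L : fieldType) (i : k -> L) (s : seq L) : L -> Prop :=
  generated (fun a => (exists c, a = i c) \/ a \in s).

Definition finite_over (L : fieldType) (A : L -> Prop) : Prop :=
  exists (n : nat) (b : 'I_n -> L), forall y : L,
    exists2 c : 'I_n -> L, (forall r, A (c r)) & y = \sum_r c r * b r.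

Definition function_field_in (k L : fieldType) (i : {rmorphism k -> L}) (x : L) :
    Prop :=
  ~ algebraicOver i x /\ finite_over (adjoin i [:: x]).

Definition function_field (k L : fieldType) (i : {rmorphism k -> L}) : Prop :=
  exists x : L, function_field_in i x.

(* f is a polynomial in U with coefficients in k[X]: in [.[u, x]] the outer
   variable U comes first. *)
Definition eval_xu (k L : fieldType) (i : k -> L) (f : {poly {poly k}}) (x u : L) :
    L :=
  (map_poly (map_poly i) f).[u, x].

(* On {poly {poly k}}, [irreducible_poly] uses pseudo-division by polynomials in
   U: it means irreducible of positive degree in k(X)[U]. *)
Definition generating_poly (k L : fieldType) (i : {rmorphism k -> L}) (x u : L)
    (f : {poly {poly k}}) : Prop :=
  [/\ irreducible_poly f, eval_xu i f x u = 0 & forall a, adjoin i [:: x; u] a].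

(* D = k(x,x';u,u') presented by the relations f(x,u) = 0 and f'(x',u') = 0.
   The last clause says that f' stays irreducible over K(x'), i.e. that K (x) K'
   over k is an integral domain, with fraction field D.  It is automatic when k
   is algebraically closed in K or in K'; without it the relations do not
   determine the field D, which would impose further algebraic relations between
   the constants of K and those of K'. *)
Record double_field (k K K' D : fieldType)
    (iK : {rmorphism k -> K}) (iK' : {rmorphism k -> K'})
    (jK : {rmorphism K -> D}) (jK' : {rmorphism K' -> D})
    (x u : K) (x' u' : K') (f' : {poly {poly k}}) : Prop := DoubleField {
  double_field_ground : jK \o iK =1 jK' \o iK';
  double_field_indep : forall p : {poly {poly k}}, p != 0 ->
    eval_xu (jK \o iK) p (jK x) (jK' x') != 0;
  double_field_gen :
    forall a, adjoin (jK \o iK) [:: jK x; jK' x'; jK u; jK' u'] a;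
  double_field_irr : irreducible_poly (map_poly (map_poly iK) f') }.

Section PrimeDivisors.

Variables (K K' D : fieldType).
Variables (jK : {rmorphism K -> D}) (jK' : {rmorphism K' -> D}).

Definition binary (m : valuation D) : Prop :=
  trivial_on jK m /\ trivial_on jK' m.

Definition K_unary (m : valuation D) : Prop :=
  trivial_on jK' m /\ ~ trivial_on jK m.

Definition K'_unary (m : valuation D) : Prop :=
  trivial_on jK m /\ ~ trivial_on jK' m.

Definition in_S (m : valuation D) : Prop :=
  [\/ binary m, K_unary m | K'_unary m].

End PrimeDivisors.

Section IsomorphismPairs.

Variables (k K K' F : fieldType).
Variables (iK : {rmorphism k -> K}) (iK' : {rmorphism k -> K'}).

Definition isomorphism_into (E : fieldType) (mu : E -> option F) : Prop :=
  exists g : {rmorphism E -> F}, forall a, mu a = Some (g a).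

(* The residue class homomorphism modulo a prime divisor of E over k, its
   residue field being embedded in F. *)
Definition residue_class_into (E : fieldType) (i : k -> E)
    (mu : E -> option F) : Prop :=
  exists (p : valuation E) (e : {rmorphism residue_field p -> F}),
    trivial_on i p /\ forall a, mu a = omap e (residue_class p a).

Record isomorphism_pair (iF : {rmorphism k -> F})
    (mu : K -> option F) (mu' : K' -> option F) : Prop := IsomorphismPair {
  iso_pair_function_field : function_field iF;
  iso_pair_ground : forall c, mu (iK c) = Some (iF c);
  iso_pair_ground' : forall c, mu' (iK' c) = Some (iF c);
  iso_pair_kind :
    [\/ isomorphism_into mu /\ isomorphism_into mu',
        residue_class_into iK mu /\ isomorphism_into mu'
      | isomorphism_into mu /\ residue_class_into iK' mu'] }.

Definition composite (mu : K -> option F) (mu' : K' -> option F) : F -> Prop :=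
  generated (fun b => (exists a, mu a = Some b) \/ (exists a, mu' a = Some b)).

End IsomorphismPairs.

(* [s] restricts to an isomorphism of the subfield C of F onto the subfield C1
   of F1; its values outside C are irrelevant. *)
Record subfield_iso (F F1 : fieldType) (C : F -> Prop) (C1 : F1 -> Prop)
    (s : F -> F1) : Prop := SubfieldIso {
  subfield_iso1 : s 1 = 1;
  subfield_isoD : forall a b, C a -> C b -> s (a + b) = s a + s b;
  subfield_isoM : forall a b, C a -> C b -> s (a * b) = s a * s b;
  subfield_iso_inj : forall a b, C a -> C b -> s a = s b -> a = b;
  subfield_iso_into : forall a, C a -> C1 (s a);
  subfield_iso_onto : forall b, C1 b -> exists2 a, C a & s a = b }.

Definition same_class (K K' F F1 : fieldType)
    (mu : K -> option F) (mu' : K' -> option F)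
    (mu1 : K -> option F1) (mu1' : K' -> option F1) : Prop :=
  exists s : F -> F1,
    [/\ subfield_iso (composite mu mu') (composite mu1 mu1') s,
        forall a, mu1 a = omap s (mu a)
      & forall a, mu1' a = omap s (mu' a)].

Definition induced (K D : fieldType) (j : {rmorphism K -> D}) (m : valuation D)
    (a : K) : option (residue_field m) :=
  residue_class m (j a).

(* Main.v *)
Require Import Defs.
From HB Require Import structures.
From mathcomp Require Import all_boot all_order all_algebra all_field.
From mathcomp Require Import generic_quotient ring_quotient boolp ring.

Set Implicit Arguments.
Unset Strict Implicit.
Unset Printing Implicit Defensive.

Import Order.TTheory GRing.Theory Num.Theory.
Local Open Scope ring_scope.
Local Open Scope quotient_scope.

(** Call a valuation m in S given, and suppose that it is trivial on K', as
    happens up to exchanging K and K'.  The residue map turns K' into a subfield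
    of the residue field, and turns K either into a subfield or, through the
    restriction of m, into the residue field of a place of K; this is the pair
    induced by m.  Conversely, let (mu, mu') be a pair with mu' an embedding into
    F, and let O be the ring of the elements of K at which mu is finite: K
    itself, or a discrete valuation ring.  Everything rests on one statement:
    mu and mu' glue to a ring homomorphism O.K' -> F, and the localization of
    O.K' at its kernel is a discrete valuation ring with fraction field D.

    - Gluing needs K and K' to be linearly disjoint over k in D.  This is where
      the irreducibility of f' over K(x') enters [irreducible_lindisj]; linear
      disjointness is kept in a form that is symmetric in K and K' [lindisj].
    - A uniformizer is already visible in O[x'].  If mu is an embedding, then
      x' becomes algebraic over the image of K, because F has transcendence
      degree 1, and its minimal polynomial generates the kernel
      [unif_algebraic].  If mu is a residue map, then x' stays transcendental
      over the residue field, and a uniformizer of O still works, as for the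
      Gauss valuation [unif_transcendental].
    - The same uniformizer works after the adjunction of u', because u' is a
      simple root of its equation over k(x'), both before and after reduction:
      the extension is unramified [unif_simple_root].
    - The maximal ideal of the localization is principal; its powers intersect
      in 0 because a nonzero element of O[x', u'] divides a nonzero element of
      O[x'] [norm_multiple].  So every nonzero element of D is a power of the
      uniformizer times a unit [order_exists], and a valuation results
      [uniformized_valuation].

    Hence every pair is induced by a prime divisor.  Applied to the pair of a
    given m, the statement produces a discrete valuation ring contained in that
    of m, hence equal to it [uniformized_val_ring].  So the valuation ring of m
    consists of the quotients p / q of elements of O.K' with q not in the
    kernel.  It follows that the residue field of m is the composite of the
    images of K and K' [induced_composite], and that m is determined by its pair
    [same_class_eqv].

    It remains to see that the residue field of m is a function field of one
    variable.  It is finite over k(x'), because D is finite over k(x', z) for a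
    suitable z in the maximal ideal of m, and a linear relation over k[x', z],
    divided by a power of z, reduces to one over k[x']
    [residue_function_field].

    Polynomial subrings are handled through a homomorphism from a polynomial
    ring into the field, its image being the ring meant, and subfields as sets
    of fractions of such images [fracp]; the pseudo-division of polynomials over
    a domain replaces the division over its fraction field. *)

(** * The residue field of a valuation *)

Section ResidueField.

Variables (L : fieldType) (v : valuation L).

Lemma val_ringE a : (a \in val_ring v) = (a == 0) || (0 <= v a).
Proof. by rewrite inE. Qed.

Definition residue (a : L) : residue_field v :=
  \pi_{ideal_quot (max_ideal v)} (insubd 0 a).

Lemma residue_classE a :
  residue_class v a = if a \in val_ring v then Some (residue a) else None.
Proof.
rewrite /residue_class /residue /insubd; case: ifP => ha; last by rewrite insubN ?ha.
by rewrite insubT.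
Qed.

Lemma insubd_valr (a : L) :
  a \in val_ring v -> val (insubd (0 : val_ring_type v) a) = a.
Proof. by move=> ha; rewrite insubdK. Qed.

Lemma residueD a b : a \in val_ring v -> b \in val_ring v ->
  residue (a + b) = residue a + residue b.
Proof.
move=> ha hb; rewrite /residue -pi_addr; congr (\pi _); apply: val_inj.
by rewrite [RHS]raddfD /= !insubd_valr ?rpredD.
Qed.

Lemma residueM a b : a \in val_ring v -> b \in val_ring v ->
  residue (a * b) = residue a * residue b.
Proof.
move=> ha hb; rewrite /residue -pi_mulr; congr (\pi _); apply: val_inj.
by rewrite [RHS]rmorphM /= !insubd_valr ?rpredM.
Qed.

Lemma residue1 : residue 1 = 1.
Proof.
rewrite /residue -pi_oner; congr (\pi _); apply: val_inj.
by rewrite insubd_valr ?rpred1.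
Qed.

Lemma residue_eq0 a : a \in val_ring v ->
  (residue a == 0) = (a == 0) || (1 <= v a).
Proof.
move=> ha; rewrite /residue -pi_zeror.
by rewrite eqmodE /= Quotient.equivE subr0 inE insubd_valr.
Qed.

Lemma residue0 : residue 0 = 0.
Proof. by apply/eqP; rewrite residue_eq0 ?rpred0 // eqxx. Qed.

Lemma residue_surj z : exists2 a, a \in val_ring v & residue a = z.
Proof.
elim/quotW: z => y; exists (val y); first exact: valP.
by rewrite /residue valKd.
Qed.

Lemma residue_eq0P a : a != 0 -> 0 <= v a -> (residue a == 0) = (0 < v a).
Proof.
move=> a0 ha; rewrite residue_eq0 ?val_ringE ?ha ?orbT // (negPf a0) /=.
by rewrite gtz0_ge1.
Qed.

Lemma residue_unit a : a \in val_ring v -> residue a != 0 -> a^-1 \in val_ring v.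
Proof.
move=> ha; have [->|a0] := eqVneq a 0; first by rewrite residue0 eqxx.
move: (ha); rewrite !val_ringE invr_eq0 (negPf a0) /= => va.
rewrite residue_eq0P // lt_neqAle va andbT negbK eq_sym valuationV // => /eqP->.
by rewrite oppr0.
Qed.

Lemma valuation_exp a n : a != 0 -> v (a ^+ n) = v a *+ n.
Proof.
move=> a0; elim: n => [|n IH]; first by rewrite expr0 valuation1 mulr0n.
by rewrite exprS valuationM ?expf_neq0 // IH mulrS.
Qed.

Lemma val_ring_inverse a : a \notin val_ring v ->
  [/\ a != 0, a^-1 \in val_ring v & residue a^-1 = 0].
Proof.
rewrite val_ringE negb_or -ltNge => /andP[a0 va].
have h : 0 < v a^-1 by rewrite valuationV // oppr_gt0.
split=> //; first by rewrite val_ringE (ltW h) orbT.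
by apply/eqP; rewrite residue_eq0P ?invr_eq0 ?(ltW h).
Qed.


Section Lift.

Variables (F : fieldType) (psi : L -> F).
Hypothesis psi1 : psi 1 = 1.
Hypothesis psiD : forall a b, a \in val_ring v -> b \in val_ring v ->
  psi (a + b) = psi a + psi b.
Hypothesis psiM : forall a b, a \in val_ring v -> b \in val_ring v ->
  psi (a * b) = psi a * psi b.
Hypothesis psi_max : forall a, a \in val_ring v -> residue a = 0 -> psi a = 0.

(** A function on the field that is multiplicative and additive on the valuation
    ring only, and vanishes on the maximal ideal, factors through the residue
    field.  All homomorphisms out of residue fields are built in this way. *)
Lemma residue_lift : exists e : {rmorphism residue_field v -> F},
  forall a, a \in val_ring v -> e (residue a) = psi a.
Proof.
pose e (z : residue_field v) := psi (val (repr z)).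
have eP a : a \in val_ring v -> e (residue a) = psi a.
  move=> ha; rewrite /e; set r := repr _.
  have hr : residue (val r) = residue a by rewrite /residue valKd reprK.
  have hd : val r - a \in val_ring v by rewrite rpredB ?(valP r).
  have d0 : psi (val r - a) = 0.
    by apply: psi_max => //; apply: (addIr (residue a)); rewrite -residueD // subrK add0r.
  by rewrite -[in LHS](subrK a (val r)) psiD // d0 add0r.
have eD : zmod_morphism e.
  move=> x y; have [a ha <-] := residue_surj x; have [b hb <-] := residue_surj y.
  have hab : a - b \in val_ring v by rewrite rpredB.
  have -> : residue a - residue b = residue (a - b).
    by apply/eqP; rewrite subr_eq -residueD // subrK.
  by rewrite !eP //; apply/eqP; rewrite eq_sym subr_eq -psiD ?subrK.
have eM : monoid_morphism e.
  split; first by rewrite -residue1 eP ?rpred1.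
  move=> x y; have [a ha <-] := residue_surj x; have [b hb <-] := residue_surj y.
  by rewrite -residueM ?eP ?psiM ?rpredM.
pose mZ := GRing.isZmodMorphism.Build _ _ e eD.
pose mM := GRing.isMonoidMorphism.Build _ _ e eM.
pose em : {rmorphism residue_field v -> F} := HB.pack e mZ mM.
by exists em.
Qed.

End Lift.

(** The integral domain structure of a valuation ring; it makes the
    pseudo-division of polynomials over that ring available. *)
Definition valr_unit : pred (val_ring_type v) :=
  fun a => (val a != 0) && ((val a)^-1 \in val_ring v).

Definition valr_inv (a : val_ring_type v) : val_ring_type v :=
  if valr_unit a then insubd a (val a)^-1 else a.

Lemma valr_mulVx : {in valr_unit, left_inverse 1 valr_inv *%R}.
Proof.
move=> a; rewrite /in_mem /= => ha; apply: val_inj; rewrite /valr_inv ha.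
move: ha => /andP[a0 ha].
by rewrite [LHS](rmorphM (val : val_ring_type v -> L)) [X in X * _]insubdK // mulVf.
Qed.

Lemma valr_unitPl (a b : val_ring_type v) : b * a = 1 -> valr_unit a.
Proof.
move=> ba1; have h : val b * val a = 1.
  by rewrite -[LHS](rmorphM (val : val_ring_type v -> L)) ba1.
have a0 : val a != 0.
  by apply/eqP=> a0; move/eqP: h; rewrite a0 mulr0 eq_sym oner_eq0.
by rewrite /valr_unit a0 -[_^-1]mul1r -h mulfK // (valP b).
Qed.

Lemma valr_invr_out : {in [predC valr_unit], valr_inv =1 id}.
Proof. by move=> a; rewrite inE /= /valr_inv /in_mem /= => /negPf ->. Qed.

HB.instance Definition _ := GRing.ComNzRing_hasMulInverse.Build (val_ring_type v)
  valr_mulVx valr_unitPl valr_invr_out.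

Lemma valr_integral (a b : val_ring_type v) : a * b = 0 -> (a == 0) || (b == 0).
Proof.
move=> /(congr1 val) /eqP; rewrite [X in X == _](rmorphM (val : val_ring_type v -> L)).
by rewrite mulf_eq0 -!(inj_eq val_inj).
Qed.

HB.instance Definition _ :=
  GRing.ComUnitRing_isIntegral.Build (val_ring_type v) valr_integral.

End ResidueField.

(** * Evaluation of polynomials and fields of fractions of images *)

(** The homomorphism from T[X] to L that extends [ev] and maps X to [s]. *)
Definition evp (T L : comNzRingType) (ev : {rmorphism T -> L}) (s : L) :
    {poly T} -> L :=
  horner_eval s \o map_poly ev.

HB.instance Definition _ (T L : comNzRingType) (ev : {rmorphism T -> L}) (s : L) :=
  GRing.RMorphism.on (evp ev s).

Section Evp.

Variables (T L : comNzRingType) (ev : {rmorphism T -> L}) (s : L).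

Lemma evpE p : evp ev s p = (map_poly ev p).[s]. Proof. by []. Qed.

Lemma evpC c : evp ev s c%:P = ev c.
Proof. by rewrite evpE map_polyC hornerC. Qed.

Lemma evpX : evp ev s 'X = s.
Proof. by rewrite evpE map_polyX hornerX. Qed.

Lemma evpZ c p : evp ev s (c *: p) = ev c * evp ev s p.
Proof. by rewrite -mul_polyC rmorphM /= evpC. Qed.

Lemma evp_sum n (p : {poly T}) : (size p <= n)%N -> evp ev s p = \sum_(i < n) ev p`_i * s ^+ i.
Proof.
move=> sp; rewrite evpE (@horner_coef_wide _ n) ?(leq_trans (size_poly _ _)) //.
by apply: eq_bigr => i _; rewrite coef_map.
Qed.

End Evp.

Lemma evp_comp (T L F : comNzRingType) (ev : {rmorphism T -> L})
    (e : {rmorphism L -> F}) s p :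
  evp (e \o ev) (e s) p = e (evp ev s p).
Proof. by rewrite !evpE map_poly_comp /= horner_map. Qed.

Lemma eq_evp (T L : comNzRingType) (ev ev' : {rmorphism T -> L}) s p :
  ev =1 ev' -> evp ev s p = evp ev' s p.
Proof. by move=> h; rewrite !evpE (eq_map_poly h). Qed.

Lemma evp_map (T L F : comNzRingType) (h : {rmorphism T -> L})
    (e : {rmorphism L -> F}) s p :
  evp e s (map_poly h p) = evp (e \o h) s p.
Proof. by rewrite !evpE -map_poly_comp. Qed.

(** A relation, rather than a function, because residue maps are ring
    homomorphisms on a valuation ring only: Q a c then says that a is integral
    and has residue c. *)
Lemma evp_rel (T L F : comNzRingType) (ev : {rmorphism T -> L})
    (phi : {rmorphism T -> F}) (Q : L -> F -> Prop) s t p :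
  (forall a b c d, Q a c -> Q b d -> Q (a + b) (c + d)) ->
  (forall a b c d, Q a c -> Q b d -> Q (a * b) (c * d)) ->
  (forall a, Q (ev a) (phi a)) -> Q s t -> Q (evp ev s p) (evp phi t p).
Proof.
move=> QD QM Qev Qs; elim/poly_ind: p => [|p c IH].
  by rewrite !rmorph0 -(rmorph0 ev) -(rmorph0 phi).
by rewrite !rmorphD !rmorphM /= !evpX !evpC; apply: QD => //; apply: QM.
Qed.

(** The subfield of L generated by the image of [ev]. *)
Definition frac (T : comNzRingType) (L : fieldType) (ev : T -> L) (y : L) : Prop :=
  exists a b, ev b != 0 /\ y = ev a / ev b.

Definition fracp (T : comNzRingType) (L : fieldType) (ev : T -> L) : {pred L} :=
  fun y => `[< frac ev y >].

Section Frac.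

Variables (T : comNzRingType) (L : fieldType) (ev : {rmorphism T -> L}).

Lemma fracP y : reflect (frac ev y) (y \in fracp ev).
Proof. exact: asboolP. Qed.

Lemma fracp_divring : divring_closed (fracp ev).
Proof.
split.
- by apply/fracP; exists 1, 1; rewrite rmorph1 oner_neq0 divr1.
- move=> _ _ /fracP[a [b [b0 ->]]] /fracP[c [d [d0 ->]]]; apply/fracP.
  exists (a * d - c * b), (b * d); rewrite rmorphB !rmorphM mulf_neq0 //; split=> //.
  by rewrite -[- (ev c / _)]mulNr addf_div // mulNr.
move=> _ _ /fracP[a [b [b0 ->]]] /fracP[c [d [d0 ->]]]; apply/fracP.
have [c0|c0] := eqVneq (ev c) 0.
  by exists 0, 1; rewrite c0 rmorph0 rmorph1 oner_neq0 !mul0r invr0 mulr0.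
exists (a * d), (b * c); rewrite !rmorphM mulf_neq0 //; split=> //.
by rewrite invf_div mulf_div.
Qed.

HB.instance Definition _ := GRing.isDivringClosed.Build L (fracp ev) fracp_divring.

Lemma frac_ev a : ev a \in fracp ev.
Proof. by apply/fracP; exists a, 1; rewrite rmorph1 oner_neq0 divr1. Qed.

Lemma common_denominator (I : finType) (y : I -> L) :
  (forall i, y i \in fracp ev) ->
  exists d (a : I -> T), ev d != 0 /\ forall i, y i = ev (a i) / ev d.
Proof.
move=> hy; have /choice[a /choice[b hb]] i := elimT (fracP _) (hy i).
exists (\prod_i b i), (fun i => a i * \prod_(j | j != i) b j); split.
  by rewrite rmorph_prod; apply/prodf_neq0 => i _; case: (hb i).
move=> i; have [bi0 ->] := hb i; rewrite [\prod_j b j](bigD1 i) //=.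
rewrite !(rmorphM ev) /= -mulf_div divff ?mulr1 //.
by rewrite rmorph_prod; apply/prodf_neq0 => j _; case: (hb j).
Qed.

End Frac.

Lemma frac_evp_ev (T : comNzRingType) (L : fieldType) (ev : {rmorphism T -> L}) s a :
  ev a \in fracp (evp ev s).
Proof. by rewrite -(evpC ev s); apply: frac_ev. Qed.

Lemma frac_evp_s (T : comNzRingType) (L : fieldType) (ev : {rmorphism T -> L}) s :
  s \in fracp (evp ev s).
Proof. by rewrite -[X in X \in _](evpX ev s); apply: frac_ev. Qed.

Lemma frac_sub (T T' : comNzRingType) (L : fieldType) (ev : {rmorphism T -> L})
    (ev' : {rmorphism T' -> L}) :
  (forall a, ev a \in fracp ev') -> {subset fracp ev <= fracp ev'}.
Proof. by move=> h _ /fracP[a [b [b0 ->]]]; rewrite rpred_div. Qed.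

Lemma frac_evp_sub (T T' : comNzRingType) (L : fieldType) (ev : {rmorphism T -> L})
    (ev' : {rmorphism T' -> L}) s :
  (forall a, ev a \in fracp ev') -> s \in fracp ev' ->
  {subset fracp (evp ev s) <= fracp ev'}.
Proof.
move=> h hs; apply: frac_sub => p /=; rewrite (evp_sum _ _ (leqnn _)).
by rewrite rpred_sum // => i _; rewrite rpredM ?rpredX.
Qed.

(** * Algebraic elements *)

(** The terms of r beyond the degree of its image contribute nothing to it;
    cutting them off makes the leading coefficient survive under [phi]. *)
Lemma truncate (T : comNzRingType) (F : comNzRingType) (phi : {rmorphism T -> F}) (r : {poly T}) :
  map_poly phi r != 0 ->
  exists r', [/\ map_poly phi r' = map_poly phi r, phi (lead_coef r') != 0
                & (size r' <= size r)%N].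
Proof.
move=> r0; set n := size (map_poly phi r).
have n0 : (0 < n)%N by rewrite size_poly_gt0.
have eqr : map_poly phi (take_poly n r) = map_poly phi r.
  apply/polyP=> i; rewrite !coef_map /= coef_take_poly; case: ltnP => // ni.
  by rewrite rmorph0 -coef_map /= nth_default.
have hc : phi (take_poly n r)`_n.-1 != 0.
  rewrite -coef_map /= eqr -/(lead_coef _) lead_coef_eq0 //.
have sr : size (take_poly n r) = n.
  apply/eqP; rewrite eqn_leq size_take_poly leqNgt /=; apply/negP=> h.
  by move: hc; rewrite nth_default ?rmorph0 ?eqxx // -ltnS prednK.
exists (take_poly n r); split=> //; first by rewrite lead_coefE sr.
by rewrite sr size_poly.
Qed.

Section Minimal.

Variables (T : idomainType) (F : idomainType) (phi : {rmorphism T -> F}) (t : F).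

(** A relation of least degree plays the part of the minimal polynomial of t
    over the fraction field of the image of T.  As [phi] need not be injective,
    least degree refers to relations whose leading coefficient survives. *)
Lemma minimal_relation (f : {poly T}) :
  evp phi t f = 0 -> map_poly phi f != 0 ->
  exists h, [/\ evp phi t h = 0, phi (lead_coef h) != 0
    & forall r : {poly T}, (size r < size h)%N -> evp phi t r = 0 -> map_poly phi r = 0].
Proof.
pose P n := `[< exists h, [/\ evp phi t h = 0, phi (lead_coef h) != 0 & size h = n] >].
move=> ft f0; have exP : exists n, P n.
  have [h [e l _]] := truncate f0; exists (size h); apply/asboolP; exists h.
  by rewrite evpE e -evpE.
case: (ex_minnP exP) => n /asboolP[h [ht hl <-]] hmin.
exists h; split=> // r rh rt; apply/eqP; apply: contraTT rh => r0; rewrite -leqNgt.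
have [r' [e l s]] := truncate r0; apply: leq_trans s; apply: hmin.
by apply/asboolP; exists r'; rewrite evpE e -evpE.
Qed.

Lemma pseudo_division (h g : {poly T}) : h != 0 ->
  exists k (q r : {poly T}), [/\ (size r < size h)%N, lead_coef h ^+ k *: g = q * h + r
    & evp phi t h = 0 -> phi (lead_coef h) ^+ k * evp phi t g = evp phi t r].
Proof.
move=> h0; exists (scalp g h), (g %/ h), (g %% h).
rewrite ltn_modpN0 // Pdiv.Idomain.divp_eq; split=> // ht.
by rewrite -rmorphXn /= -evpZ Pdiv.Idomain.divp_eq rmorphD rmorphM /= ht mulr0 add0r.
Qed.

End Minimal.

Section Algebraic.

Variables (T : idomainType) (L : fieldType) (ev : {rmorphism T -> L}).
Hypothesis ev_inj : injective ev.

Let ev_eq0 a : (ev a == 0) = (a == 0).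
Proof. by rewrite -(rmorph0 ev) (inj_eq ev_inj). Qed.

Definition algebraic_over (s : L) := exists2 f : {poly T}, f != 0 & evp ev s f = 0.

Lemma map_ev_eq0 p : (map_poly ev p == 0) = (p == 0).
Proof.
apply/eqP/eqP => [|->]; last by rewrite rmorph0.
by move=> h; apply/polyP=> i; apply: ev_inj; rewrite coef0 rmorph0 -coef_map /= h coef0.
Qed.

Lemma algebraic_minimal s : algebraic_over s ->
  exists h, [/\ evp ev s h = 0, h != 0
    & forall r : {poly T}, (size r < size h)%N -> evp ev s r = 0 -> r = 0].
Proof.
case=> f f0 fs; have [|h [hs hl hm]] := minimal_relation fs; first by rewrite map_ev_eq0.
exists h; split=> //; first by rewrite -lead_coef_eq0 -ev_eq0.
by move=> r rh rs; apply/eqP; rewrite -map_ev_eq0 hm.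
Qed.

(** The minimal polynomial h of s and a polynomial g that does not vanish at s are
    coprime.  A Euclidean induction on the degree of g, dividing h by g, finds
    the multiple of g(s) that lies in the base ring, as the norm of g(s) does. *)
Lemma norm_multiple s : algebraic_over s -> forall g, evp ev s g != 0 ->
  exists g' a, evp ev s (g' * g) = ev a /\ ev a != 0.
Proof.
move=> /algebraic_minimal[h [hs h0 hmin]].
suff H n (g : {poly T}) : (size g <= n)%N -> (size g < size h)%N -> evp ev s g != 0 ->
    exists g' a, evp ev s (g' * g) = ev a /\ ev a != 0.
  move=> g g0; have [k [q [r [rh _ /(_ hs) er]]]] := pseudo_division ev s g h0.
  have r0 : evp ev s r != 0.
    by rewrite -er mulf_neq0 // expf_neq0 // ev_eq0 lead_coef_eq0.
  have [g' [a [ea a0]]] := H _ r (leqnn _) rh r0.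
  exists (g' * (lead_coef h ^+ k)%:P), a; split=> //.
  by rewrite -ea !rmorphM /= evpC rmorphXn /= -mulrA er.
elim: n g => [|n IH] g sn sh g0.
  by move: g0; rewrite (eqP (_ : g == 0)) ?rmorph0 ?eqxx // -size_poly_leq0.
have [s1|s1] := leqP (size g) 1.
  by move: g0; rewrite (size1_polyC s1) evpC => c0; exists 1, g`_0; rewrite mul1r evpC.
have gn0 : g != 0 by apply: contraNneq g0 => ->; rewrite rmorph0.
have [k [q [r [rg er _]]]] := pseudo_division ev s h gn0.
have lk : lead_coef g ^+ k != 0 by rewrite expf_neq0 // lead_coef_eq0.
have er' : evp ev s r = - evp ev s q * evp ev s g.
  apply/eqP; rewrite mulNr -addr_eq0 addrC -rmorphM -rmorphD /= -er.
  by rewrite evpZ hs mulr0.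
have [r0|r0] := eqVneq (evp ev s r) 0; last first.
  have [||g' [a [ea a0]]] := IH r _ _ r0.
  - by rewrite -ltnS (leq_trans rg).
  - exact: ltn_trans rg sh.
  exists (- (g' * q)), a; split=> //; rewrite -ea rmorphM rmorphM /= er' rmorphN rmorphM /=.
  by rewrite !mulNr mulrN mulrA.
have rE : r = 0 by apply: hmin r0; apply: ltn_trans rg sh.
have qs : evp ev s q = 0.
  move: er'; rewrite r0 => /esym/eqP; rewrite mulf_eq0 (negPf g0) orbF oppr_eq0.
  by move/eqP.
have q0 : q != 0.
  apply: contraNneq h0 => q0; move/eqP: er.
  by rewrite q0 rE mul0r addr0 -mul_polyC mulf_eq0 polyC_eq0 (negPf lk).
case/eqP: (q0); apply: hmin qs.
rewrite -(size_scale h lk) er rE addr0 size_mul //.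
by case: (size g) s1 => [//|[//|m]] _; rewrite !addnS /= ltnS leq_addr.
Qed.

(** The reduced form of an element of T(s): by [norm_multiple] the denominator
    may be taken in T, and the numerator is reduced modulo f. *)
Lemma frac_evp_reduced s f : f != 0 -> evp ev s f = 0 ->
  forall y, y \in fracp (evp ev s) -> exists (r : {poly T}) d,
    [/\ (size r < size f)%N, ev d != 0 & y = evp ev s r / ev d].
Proof.
move=> f0 fs _ /fracP[a [b [b0 ->]]].
have [|b' [d [ed d0]]] := @norm_multiple s _ b b0; first by exists f.
have [k [q [r [rf _ /(_ fs) er]]]] := pseudo_division ev s (a * b') f0.
have l0 : ev (lead_coef f) ^+ k != 0 by rewrite expf_neq0 // ev_eq0 lead_coef_eq0.
exists r, (lead_coef f ^+ k * d); rewrite rmorphM rmorphXn mulf_neq0 //; split=> //=.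
rewrite -er -mulf_div divff // mul1r -ed !rmorphM /=.
have b'0 : evp ev s b' != 0.
  by apply: contraNneq d0 => b'0; rewrite -ed rmorphM /= b'0 mul0r.
by rewrite (mulrC _ (evp ev s b)) -mulf_div divff // mulr1.
Qed.

End Algebraic.

(** * Finiteness over a field of fractions *)

(** V is contained in a finite dimensional space over the field of fractions of
    the image of [ev]. *)
Definition fin_span (T : comNzRingType) (L : fieldType) (ev : T -> L)
    (V : {pred L}) : Prop :=
  exists (I : finType) (b : I -> L), forall y, y \in V ->
    exists2 c : I -> L, (forall i, c i \in fracp ev) & y = \sum_i c i * b i.

Lemma frac_evp_coefs (T : idomainType) (L : fieldType) (ev : {rmorphism T -> L}) s f :
  injective ev -> f != 0 -> evp ev s f = 0 ->
  forall y, y \in fracp (evp ev s) -> exists2 c : 'I_(size f).-1 -> L,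
    (forall i, c i \in fracp ev) & y = \sum_i c i * s ^+ i.
Proof.
move=> inj f0 fs y hy; have [r [d [rf d0 ->]]] := frac_evp_reduced inj f0 fs hy.
exists (fun i : 'I__ => ev r`_i / ev d); first by move=> i; rewrite rpred_div ?frac_ev.
have rn : (size r <= (size f).-1)%N by rewrite -ltnS (ltn_predK rf).
by rewrite (evp_sum _ _ rn) mulr_suml; apply: eq_bigr => i _; rewrite mulrAC.
Qed.

Lemma fin_span_evp (T : idomainType) (L : fieldType) (ev : {rmorphism T -> L}) s :
  injective ev -> algebraic_over ev s -> fin_span ev (fracp (evp ev s)).
Proof.
move=> inj [f f0 fs]; exists 'I_(size f).-1, (fun i : 'I__ => s ^+ i).
exact: frac_evp_coefs.
Qed.

Lemma fin_span_trans (T T' : comNzRingType) (L : fieldType)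
    (ev : {rmorphism T -> L}) (ev' : {rmorphism T' -> L}) (V W : {pred L}) :
  fin_span ev V -> {subset fracp ev' <= V} -> fin_span ev' W -> fin_span ev W.
Proof.
move=> [I [b hb]] sV [J [b' hb']]; exists (I * J)%type, (fun ij => b ij.1 * b' ij.2).
move=> y /hb'[c hc ->]; have /choice[d hd] j : exists d : I -> L,
    (forall i, d i \in fracp ev) /\ c j = \sum_i d i * b i.
  by have [d h1 h2] := hb _ (sV _ (hc j)); exists d.
exists (fun ij => d ij.2 ij.1); first by case=> i j; case: (hd j) => /(_ i).
rewrite -(pair_bigA _ (fun i j => d j i * (b i * b' j))) exchange_big /=.
apply: eq_bigr => j _; have [_ ->] := hd j; rewrite mulr_suml.
by apply: eq_bigr => i _; rewrite mulrA.
Qed.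

Lemma fin_span_sub (T : comNzRingType) (L : fieldType) (ev : {rmorphism T -> L})
    (V W : {pred L}) :
  {subset W <= V} -> fin_span ev V -> fin_span ev W.
Proof. by move=> sW [I [b hb]]; exists I, b => y /sW/hb. Qed.

Lemma fraction_frac (T : idomainType) (x : {fraction T}) :
  x \in fracp (@tofrac T).
Proof.
elim/quotW: x => r; apply/fracP; exists \n_r, \d_r.
have d0 : tofrac \d_r != 0 by rewrite tofrac_eq0 denom_ratioP.
split=> //; apply: (canRL (mulfK d0)).
transitivity (\pi_(FracField.type T) (Ratio \n_r 1)); last first.
  by rewrite -[RHS]/(FracField.tofrac _) !piE.
rewrite !piE; apply/eqP; rewrite FracField.equivf_def /FracField.mulf.
by rewrite !numden_Ratio ?mulf_neq0 ?denom_ratioP ?oner_neq0 // !mulr1 mulrC.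
Qed.

(** The rows outnumber the columns, so a linear relation exists over the fraction
    field; its denominators are then cleared. *)
Lemma kernel_vector (T : idomainType) (I J : finType) (A : I -> J -> T) :
  (#|J| < #|I|)%N ->
  exists2 v : I -> T, (exists i, v i != 0) & forall j, \sum_i v i * A i j = 0.
Proof.
move=> JI; pose M := \matrix_(i < #|I|, j < #|J|) tofrac (A (enum_val i) (enum_val j)).
have /rowV0Pn[w /sub_kermxP wM w0] : kermx M != 0.
  by rewrite kermx_eq0 /row_free neq_ltn (leq_ltn_trans (rank_leq_col _) JI).
have [d [a [d0 ha]]] := common_denominator (fun i => fraction_frac (w 0 (enum_rank i))).
exists a => [|j].
  have [i wi] : exists i, w 0 i != 0.
    by apply/existsP; apply: contraNT w0 => /existsPn h; apply/eqP/rowP=> i;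
       rewrite mxE; apply/eqP; rewrite -[_ == _]negbK h.
  exists (enum_val i); apply: contraNneq wi => ai.
  by have := ha (enum_val i); rewrite enum_valK ai rmorph0 mul0r => ->.
apply/eqP; rewrite -tofrac_eq0 rmorph_sum /=.
have /rowP/(_ (enum_rank j)) := wM; rewrite !mxE => h.
rewrite -(mulIr_eq0 _ (mulIf (invr_neq0 d0))) mulr_suml.
rewrite -[X in _ == X]h; apply/eqP.
rewrite (reindex_onto enum_val enum_rank) => [|i _]; last exact: enum_rankK.
rewrite (eq_bigl xpredT) => [|i]; last by rewrite enum_valK eqxx.
apply: eq_bigr => i _; have := ha (enum_val i); rewrite enum_valK => ->.
by rewrite mxE enum_rankK rmorphM mulrAC.
Qed.

Section Dependency.

Variables (T : idomainType) (L : fieldType) (ev : {rmorphism T -> L}).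

(** The coordinates of y with respect to the spanning family, multiplied by a
    common denominator, form a matrix with more rows than columns. *)
Lemma fin_span_dependent (V : {pred L}) : fin_span ev V ->
  exists N, forall (I : finType) (y : I -> L), (N < #|I|)%N -> (forall i, y i \in V) ->
  exists2 v : I -> T, (exists i, v i != 0) & \sum_i ev (v i) * y i = 0.
Proof.
move=> [J [b hb]]; exists #|J| => I y JI hy.
have /choice[c hc] i : exists c, (forall j, c j \in fracp ev) /\ y i = \sum_j c j * b j.
  by have [c h1 h2] := hb _ (hy i); exists c.
have [[i j]|d [A [d0 hA]]] := @common_denominator _ _ ev (I * J)%type (fun ij => c ij.1 ij.2).
  by case: (hc i).
have [v v0 hv] := kernel_vector (fun i j => A (i, j)) JI; exists v => //.
apply: (mulfI d0); rewrite mulr0 mulr_sumr.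
have e i : ev d * (ev (v i) * y i) = \sum_j ev (v i * A (i, j)) * b j.
  have [_ ->] := hc i; rewrite mulrCA mulr_sumr mulr_sumr; apply: eq_bigr => j _.
  by rewrite (hA (i, j)) /= [ev d * (_ * _)]mulrA [ev d * (_ / _)]mulrC divfK // mulrA -rmorphM.
rewrite (eq_bigr _ (fun i _ => e i)) exchange_big big1 // => j _ /=.
by rewrite -mulr_suml -rmorph_sum hv rmorph0 mul0r.
Qed.

(** The powers of y are linearly dependent. *)
Lemma fin_span_algebraic (V : {pred L}) y : fin_span ev V ->
  (forall n, y ^+ n \in V) -> algebraic_over ev y.
Proof.
move=> /fin_span_dependent[N hN] hy.
have [|i|v [i vi] hv] := hN 'I_N.+1 (fun i : 'I__ => y ^+ i); rewrite ?card_ord //.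
have vE (j : 'I_N.+1) : (\poly_(j < N.+1) v (inord j))`_j = v j.
  by rewrite coef_poly ltn_ord inord_val.
exists (\poly_(j < N.+1) v (inord j)).
  by apply: contraNneq vi => p0; rewrite -vE p0 coef0.
rewrite (evp_sum _ _ (size_poly _ _)) -[RHS]hv.
by apply: eq_bigr => j _; rewrite vE.
Qed.

End Dependency.

(** * Discrete valuation rings as localizations at the kernel of a homomorphism *)

(** The data making the localization of ev(T) at the kernel of [phi] a discrete
    valuation ring with uniformizer ev(pi).  By [unif_div], pi generates the
    maximal ideal of the localization; [unif_bound] bounds the power of pi that
    divides a given nonzero element a, since a divides pi ^+ r up to a unit.
    This bound is how the vanishing of the intersection of the powers of the
    maximal ideal is verified in towers of extensions. *)
Record uniformized (T L F : comNzRingType) (ev : T -> L) (phi : T -> F) (pi : T) :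
    Prop := Uniformized {
  unif_ker : forall a, ev a = 0 -> phi a = 0;
  unif_neq0 : ev pi != 0;
  unif_pi : phi pi = 0;
  unif_div : forall a, phi a = 0 ->
    exists q c, phi q != 0 /\ ev (q * a) = ev (pi * c);
  unif_bound : forall a, ev a != 0 ->
    exists b r c, phi c != 0 /\ ev (a * b) = ev (pi ^+ r * c) }.

(** The localization itself, as a subset of L. *)
Definition localp (T : comNzRingType) (L F : fieldType) (ev : T -> L) (phi : T -> F) :
    {pred L} :=
  fun y => `[< exists a b, phi b != 0 /\ y = ev a / ev b >].

Section Localization.

Variables (T : comNzRingType) (L F : fieldType).
Variables (ev : {rmorphism T -> L}) (phi : {rmorphism T -> F}) (pi : T).
Hypothesis U : uniformized ev phi pi.

Local Notation R := (localp ev phi).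

Lemma localP y : reflect (exists a b, phi b != 0 /\ y = ev a / ev b) (y \in R).
Proof. exact: asboolP. Qed.

Lemma unif_ev_neq0 a : phi a != 0 -> ev a != 0.
Proof. by apply: contra_neq => /(unif_ker U). Qed.

Lemma localp_subring : subring_closed R.
Proof.
split.
- by apply/localP; exists 1, 1; rewrite !rmorph1 oner_neq0 divr1.
- move=> _ _ /localP[a [b [b0 ->]]] /localP[c [d [d0 ->]]]; apply/localP.
  exists (a * d - c * b), (b * d); rewrite rmorphB !rmorphM mulf_neq0 //; split=> //.
  by rewrite -[- (ev c / _)]mulNr addf_div ?unif_ev_neq0 // mulNr.
move=> _ _ /localP[a [b [b0 ->]]] /localP[c [d [d0 ->]]]; apply/localP.
by exists (a * c), (b * d); rewrite !rmorphM mulf_neq0 // mulf_div.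
Qed.

HB.instance Definition _ := GRing.isSubringClosed.Build L R localp_subring.

Lemma localp_ev a : ev a \in R.
Proof. by apply/localP; exists a, 1; rewrite !rmorph1 oner_neq0 divr1. Qed.

Lemma localp_unit a b : phi a != 0 -> phi b != 0 -> ev a / ev b \in R.
Proof. by move=> a0 b0; apply/localP; exists a, b. Qed.

(** Divide by pi as long as [phi] kills the quotient: each division lowers by one
    the exponent r of [unif_bound], so that the process stops. *)
Lemma unif_factor a : ev a != 0 -> exists n q c,
  [/\ phi q != 0, phi c != 0 & ev (q * a) = ev (pi ^+ n * c)].
Proof.
move=> a0; have [b [r [c [c0 h]]]] := unif_bound U a0.
elim: r => [|r IH] in a a0 b c c0 h *.
  have [ka|ka] := eqVneq (phi a) 0; last first.
    by exists 0%N, 1, a; rewrite rmorph1 oner_neq0 expr0 mul1r.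
  have /(unif_ker U)/eqP : ev (a * b - pi ^+ 0 * c) = 0 by rewrite rmorphB h subrr.
  by rewrite rmorphB !rmorphM ka mul0r expr0 rmorph1 mul1r sub0r oppr_eq0 (negPf c0).
have [ka|ka] := eqVneq (phi a) 0; last first.
  by exists 0%N, 1, a; rewrite rmorph1 oner_neq0 expr0 mul1r.
have [q [d [q0 e]]] := unif_div U ka.
have d0 : ev d != 0.
  have : ev (q * a) != 0 by rewrite rmorphM mulf_neq0 // unif_ev_neq0.
  by apply: contraNneq => d0; rewrite e rmorphM /= d0 mulr0.
have [||n [q' [c' [q'0 c'0 e']]]] := IH d d0 b (q * c).
- by rewrite rmorphM mulf_neq0.
- apply: (mulfI (unif_neq0 U)); rewrite -!rmorphM mulrA rmorphM /= -e -rmorphM /=.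
  by rewrite -mulrA rmorphM /= h -rmorphM /= exprS; congr (ev _); ring.
exists n.+1, (q' * q), c'; rewrite rmorphM mulf_neq0 //; split=> //.
have -> : ev (q' * q * a) = ev pi * ev (q' * d).
  by rewrite -mulrA rmorphM /= e -!rmorphM; congr (ev _); ring.
by rewrite e' -rmorphM exprS mulrA.
Qed.

Hypothesis fr : forall y, y \in fracp ev.

Definition order_at (y : L) (z : int) : Prop := exists a b,
  [/\ phi a != 0, phi b != 0 & y = ev pi ^ z * (ev a / ev b)].

Lemma order_exists y : y != 0 -> exists z, order_at y z.
Proof.
have /fracP[a [b [b0 ->]]] := fr y; rewrite mulf_eq0 invr_eq0 negb_or => /andP[a0 _].
have [n [q [c [q0 c0 e]]]] := unif_factor a0.
have [n' [q' [c' [q'0 c'0 e']]]] := unif_factor b0.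
exists (n%:Z - n'%:Z), (c * q'), (c' * q); rewrite !rmorphM !mulf_neq0 //; split=> //.
have p0 := unif_neq0 U.
have ea : ev a = ev pi ^+ n * ev c / ev q.
  by apply: (canRL (mulfK (unif_ev_neq0 q0))); rewrite -rmorphXn -!rmorphM -e mulrC.
have eb : ev b = ev pi ^+ n' * ev c' / ev q'.
  by apply: (canRL (mulfK (unif_ev_neq0 q'0))); rewrite -rmorphXn -!rmorphM -e' mulrC.
rewrite ea eb expfzDr // -exprnP -exprnN.
by field; rewrite expf_neq0 ?p0 // !unif_ev_neq0.
Qed.

Lemma order_atM y y' z z' : order_at y z -> order_at y' z' -> order_at (y * y') (z + z').
Proof.
move=> [a [b [a0 b0 ->]]] [c [d [c0 d0 ->]]]; exists (a * c), (b * d).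
rewrite !rmorphM !mulf_neq0 // expfzDr ?(unif_neq0 U) //; split=> //.
by field; rewrite ?unif_ev_neq0.
Qed.

Lemma order_pi n : order_at (ev pi ^ n) n.
Proof. by exists 1, 1; rewrite !rmorph1 oner_neq0 divr1 mulr1. Qed.

Lemma order_localp y z : order_at y z -> (y \in R) = (0 <= z).
Proof.
move=> [a [b [a0 b0 ->]]]; apply/idP/idP; last first.
  case: z => // n _; rewrite rpredM ?localp_unit //.
  by rewrite -exprnP rpredX ?localp_ev.
case: z => // n /localP[c [d [d0 e]]]; exfalso.
have p0 := unif_neq0 U.
have e' : ev (a * d - pi ^+ n.+1 * (c * b)) = 0.
  apply/eqP; rewrite rmorphB !rmorphM rmorphXn subr_eq0; apply/eqP.
  have -> : ev c = ev c / ev d * ev d by rewrite divfK ?unif_ev_neq0.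
  rewrite -e NegzE -exprnN; field.
  by rewrite expf_neq0 ?p0 // !unif_ev_neq0.
move/eqP: (unif_ker U e').
rewrite rmorphB !rmorphM rmorphXn /= (unif_pi U) expr0n mul0r subr0 mulf_eq0.
by rewrite (negPf a0) (negPf d0).
Qed.

Lemma order_ge y z n : order_at y z -> (y * ev pi ^ (- n) \in R) = (n <= z).
Proof. by move=> h; rewrite (order_localp (order_atM h (order_pi _))) subr_ge0. Qed.

Lemma order_uniq y z z' : order_at y z -> order_at y z' -> z = z'.
Proof.
move=> h h'; apply/eqP; rewrite eq_le.
by rewrite -(order_ge z h') -(order_ge z' h) (order_ge z h) (order_ge z' h') !lexx.
Qed.

Lemma uniformized_valuation : exists w : valuation L,
  forall y, (y \in val_ring w) = (y \in R).
Proof.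
have /choice[w hw] y : exists z, y != 0 -> order_at y z.
  by have [_|/order_exists[z hz]] := eqVneq y 0; [exists 0 | exists z].
have wM a b : a != 0 -> b != 0 -> w (a * b) = w a + w b.
  move=> a0 b0; apply: order_uniq (hw _ _) _; first by rewrite mulf_neq0.
  by apply: order_atM; apply: hw.
have wD a b : a != 0 -> b != 0 -> a + b != 0 -> Num.min (w a) (w b) <= w (a + b).
  move=> a0 b0 ab0; rewrite -(order_ge _ (hw _ ab0)) mulrDl rpredD //.
    by rewrite (order_ge _ (hw _ a0)) ge_min lexx.
  by rewrite (order_ge _ (hw _ b0)) ge_min lexx orbT.
have w1 : exists2 a, a != 0 & w a = 1.
  exists (ev pi); first exact: (unif_neq0 U).
  by apply: order_uniq (hw _ (unif_neq0 U)) _; rewrite -[ev pi]expr1z; apply: order_pi.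
exists (Valuation wM wD w1) => y; rewrite val_ringE /=.
have [->|y0] := eqVneq y 0; first by rewrite rpred0.
by rewrite (order_localp (hw _ y0)).
Qed.

(** A valuation m that is non-negative on the localization is 0 on its units and
    positive on the uniformizer, as otherwise m would be trivial.  So m is a
    positive multiple of the order: a discrete valuation ring is maximal among
    the proper subrings of its fraction field. *)
Lemma uniformized_val_ring (m : valuation L) :
  (forall a, ev a \in val_ring m) ->
  (forall a, phi a != 0 -> (ev a)^-1 \in val_ring m) ->
  forall y, (y \in val_ring m) = (y \in R).
Proof.
move=> hev hu y; have [->|y0] := eqVneq y 0; first by rewrite !rpred0.
have p0 := unif_neq0 U.
have m_unit a : phi a != 0 -> m (ev a) = 0.
  move=> a0; have ea := unif_ev_neq0 a0.
  have := hu a a0; have := hev a; rewrite !val_ringE invr_eq0 (negPf ea) /= => h1.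
  by rewrite valuationV // oppr_ge0 => h2; apply/eqP; rewrite eq_le h1 h2.
have m_order x z : order_at x z -> m x = z * m (ev pi).
  have mV a b : phi a != 0 -> phi b != 0 -> m (ev a / ev b) = 0.
    by move=> a0 b0; rewrite valuationM ?invr_eq0 ?valuationV ?unif_ev_neq0 ?m_unit // oppr0.
  move=> [a [b [a0 b0 ->]]].
  rewrite valuationM ?expfz_neq0 // ?mulf_neq0 ?invr_eq0 ?unif_ev_neq0 // mV // addr0.
  case: z => n; first by rewrite -exprnP valuation_exp // -mulr_natl natz.
  by rewrite NegzE -exprnN valuationV ?expf_neq0 // valuation_exp // mulNr -mulr_natl natz.
have mpi : 0 < m (ev pi).
  have := hev pi; rewrite val_ringE (negPf p0) /= le_eqVlt => /orP[/eqP h|//].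
  have [x x0 mx] := valuation_normalized m; have [z hz] := order_exists x0.
  by move: mx; rewrite (m_order _ _ hz) -h mulr0.
have [z hz] := order_exists y0.
by rewrite val_ringE (negPf y0) (m_order _ _ hz) (order_localp hz) pmulr_lge0.
Qed.

End Localization.

(** If p has m-order 1 then n = n(p) m, and n(p) = 1 as n is normalized. *)
Lemma val_ring_eqv (L : fieldType) (m n : valuation L) :
  {subset val_ring m <= val_ring n} -> eqv_valuation m n.
Proof.
move=> sub.
have le0 a : a != 0 -> 0 <= m a -> 0 <= n a.
  move=> a0 ma; have := sub a; rewrite !val_ringE (negPf a0) /=; exact.
have eq0 a : a != 0 -> m a = 0 -> n a = 0.
  move=> a0 ma; apply/eqP; rewrite eq_le le0 ?ma // andbT -oppr_ge0 -valuationV //.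
  by rewrite le0 ?invr_eq0 ?valuationV // ma oppr0.
have [p p0 mp] := valuation_normalized m; have [q q0 nq] := valuation_normalized n.
have np : 0 <= n p by rewrite le0 ?mp.
have H a : a != 0 -> n a = m a * n p.
  move=> a0.
  have E x : x != 0 -> 0 <= m x -> n x = m x * n p.
    move=> x0; case E : (m x) => [k|//] _.
    have pk : p ^+ k != 0 by rewrite expf_neq0.
    have : n (x / p ^+ k) = 0.
      apply: eq0; first by rewrite mulf_neq0 ?invr_eq0.
      by rewrite valuationM ?invr_eq0 // valuationV // valuation_exp // mp E natz subrr.
    rewrite valuationM ?invr_eq0 // valuationV // valuation_exp // => /eqP.
    by rewrite subr_eq0 => /eqP ->; rewrite -mulr_natl natz.
  have [h|h] := leP 0 (m a); first exact: E.
  apply: oppr_inj; rewrite -valuationV // E ?invr_eq0 ?valuationV ?mulNr //.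
  by rewrite oppr_ge0 ltW.
move=> a a0; rewrite H //; suff -> : n p = 1 by rewrite mulr1.
have := H _ q0; rewrite nq => h.
have : (n p %| 1)%Z by apply/dvdzP; exists (m q).
by rewrite dvdz1 => /eqP e; apply/eqP; rewrite -(gez0_abs np) e.
Qed.

(** * Uniformizers in polynomial extensions *)

(** [unif_div] applied to the coefficients, with the product of the multipliers. *)
Lemma unif_div_poly (T : comNzRingType) (L F : idomainType) (ev : {rmorphism T -> L})
    (phi : {rmorphism T -> F}) pi (g : {poly T}) :
  uniformized ev phi pi -> map_poly phi g = 0 ->
  exists q c, phi q != 0 /\ map_poly ev (q%:P * g) = map_poly ev (pi%:P * c).
Proof.
move=> U; elim/poly_ind: g => [|p c IH].
  by exists 1, 0; rewrite rmorph1 oner_neq0 !mulr0.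
rewrite rmorphD rmorphM /= map_polyX map_polyC /= => h.
have c0 : phi c = 0.
  by have := congr1 (fun p : {poly F} => p`_0) h; rewrite coefD coefMX coefC add0r coef0.
have /eqP : map_poly phi p * 'X = 0 by move: h; rewrite c0 addr0.
rewrite mulf_eq0 polyX_eq0 orbF => /eqP/IH[q [d [q0 e]]].
have [q' [d' [q'0 e']]] := unif_div U c0.
exists (q * q'), (q'%:P * d * 'X + (q * d')%:P); rewrite rmorphM mulf_neq0 //; split=> //.
have -> : (q * q')%:P * (p * 'X + c%:P) = q'%:P * (q%:P * p) * 'X + q%:P * (q' * c)%:P.
  by rewrite !polyCM; ring.
have -> : pi%:P * (q'%:P * d * 'X + (q * d')%:P) =
    q'%:P * (pi%:P * d) * 'X + q%:P * (pi * d')%:P by rewrite !polyCM; ring.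
rewrite [LHS]rmorphD [RHS]rmorphD /=; congr (_ + _).
  rewrite rmorphM [in RHS]rmorphM /=; congr (_ * _).
  by rewrite rmorphM [in RHS]rmorphM /= e.
by rewrite rmorphM [in RHS]rmorphM /= !map_polyC /= e'.
Qed.

(** Unramified extensions keep the uniformizer.  Let h be minimal for t over the
    image of [phi].  A polynomial g with g(t) = 0 and the equation f both become
    multiples of h modulo pi, say g = c h and f = q h up to units.  Then
    q(s) g(s) = c(s) f(s) = 0 modulo pi, and q(t) <> 0 because t is a simple root
    of f: up to the unit q(s), the element g(s) is a multiple of pi. *)
Lemma unif_simple_root (T : idomainType) (L F : fieldType) (ev : {rmorphism T -> L})
    (phi : {rmorphism T -> F}) pi (s : L) (t : F) (f : {poly T}) :
  injective ev -> uniformized ev phi pi ->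
  evp ev s f = 0 -> evp phi t f = 0 -> evp phi t f^`() != 0 ->
  (forall g, evp ev s g = 0 -> evp phi t g = 0) ->
  uniformized (evp ev s) (evp phi t) pi%:P.
Proof.
move=> inj U fs ft f't hker.
have mf0 : map_poly phi f != 0.
  by apply: contraNneq f't => e; rewrite evpE -deriv_map e deriv0 horner0.
have f0 : f != 0 by apply: contraNneq mf0 => ->; rewrite rmorph0.
split=> //; rewrite ?evpC; [exact: unif_neq0 U | exact: unif_pi U | |].
- move=> g gt; have [h [ht hl hmin]] := minimal_relation ft mf0.
  have h0 : h != 0 by apply: contraNneq hl => ->; rewrite lead_coef0 rmorph0.
  have [k [c [r [rh er /(_ ht) tr]]]] := pseudo_division phi t g h0.
  have [j [q [r' [r'h er' /(_ ht) tr']]]] := pseudo_division phi t f h0.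
  have mr : map_poly phi r = 0 by apply: hmin => //; rewrite -tr gt mulr0.
  have mr' : map_poly phi r' = 0 by apply: hmin => //; rewrite -tr' ft mulr0.
  set l := lead_coef h in hl er er'.
  have qt : evp phi t q != 0.
    apply: contraNneq f't => q0; rewrite -(mulrI_eq0 _ (mulfI (expf_neq0 j hl))).
    rewrite -rmorphXn /= -evpZ -derivZ er' derivD derivM rmorphD rmorphD !rmorphM /=.
    rewrite q0 ht [evp phi t r'^`()]evpE -deriv_map mr' deriv0 horner0.
    by rewrite !(mulr0, mul0r, addr0).
  (* the part of q g that is not a multiple of f has coefficients in the kernel *)
  have [Q [C [Q0 eC]]] : exists q' c', phi q' != 0 /\
      map_poly ev (q'%:P * (q * r - r' * c)) = map_poly ev (pi%:P * c').
    by apply: unif_div_poly U _; rewrite rmorphB !rmorphM /= mr mr' mulr0 mul0r subrr.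
  exists (Q%:P * (q * (l ^+ k)%:P)), C; split.
    by rewrite !rmorphM /= !evpC rmorphXn !mulf_neq0 // expf_neq0.
  have -> : Q%:P * (q * (l ^+ k)%:P) * g = Q%:P * (q * (l ^+ k *: g)).
    by rewrite -mul_polyC !mulrA.
  rewrite er.
  have -> : Q%:P * (q * (c * h + r)) =
      Q%:P * (q * r - r' * c) + Q%:P * c * (q * h + r').
    by ring.
  by rewrite -er' rmorphD [X in _ + X]rmorphM /= evpZ fs !mulr0 addr0 !evpE eC.
- move=> g g0; have [|g' [a [ea a0]]] := norm_multiple inj _ g0; first by exists f.
  have [b [r [c [c0 e]]]] := unif_bound U a0.
  exists (g' * b%:P), r, c%:P; rewrite evpC; split=> //.
  rewrite -polyC_exp -polyCM evpC -e mulrCA mulrA rmorphM /= ea evpC.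
  by rewrite rmorphM.
Qed.

(** The Gauss extension: as t is transcendental over the residue field, a
    polynomial over T is a non-unit exactly when all its coefficients are.  The
    order of its leading coefficient bounds its divisibility by pi. *)
Lemma unif_transcendental (T : idomainType) (L F : fieldType) (ev : {rmorphism T -> L})
    (phi : {rmorphism T -> F}) pi (s : L) (t : F) :
  injective (evp ev s) -> uniformized ev phi pi ->
  (forall g, evp phi t g = 0 -> map_poly phi g = 0) ->
  uniformized (evp ev s) (evp phi t) pi%:P.
Proof.
move=> inj U ht.
have inj0 : injective ev by move=> a b h; apply: polyC_inj; apply: inj; rewrite !evpC.
have injm : injective (map_poly ev).
  by move=> p q h; apply: inj; rewrite !evpE h.
have divg g : map_poly phi g = 0 -> exists q c, phi q != 0 /\ q%:P * g = pi%:P * c.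
  by move=> /(unif_div_poly U)[q [c [q0 /injm e]]]; exists q, c.
split; rewrite ?evpC; [ | exact: unif_neq0 U | exact: unif_pi U | |].
- by move=> g; rewrite -[RHS](rmorph0 (evp ev s)) => /inj->; rewrite rmorph0.
- by move=> g /ht/divg[q [c [q0 e]]]; exists q%:P, c; rewrite e evpC.
move=> g g0.
have gn0 : g != 0 by apply: contraNneq g0 => ->; rewrite rmorph0.
have li : ev (lead_coef g) != 0.
  by rewrite -(rmorph0 ev) (inj_eq inj0) lead_coef_eq0.
have [b [r [c [c0 /inj0]]]] := unif_bound U li.
rewrite lead_coefE; move: (size g).-1 => i {g0 gn0 li}.
elim: r => [|r IH] in g b c c0 * => e.
  have [ge|ge] := eqVneq (map_poly phi g) 0; last first.
    by exists 1, 0%N, g; rewrite mulr1 expr0 mul1r; split=> //; apply: contra_neq ge => /ht.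
  move/(congr1 phi): e; rewrite expr0 mul1r rmorphM /= -coef_map /= ge coef0 mul0r.
  by move=> e; rewrite -e eqxx in c0.
have [ge|ge] := eqVneq (map_poly phi g) 0; last first.
  by exists 1, 0%N, g; rewrite mulr1 expr0 mul1r; split=> //; apply: contra_neq ge => /ht.
have [q [d [q0 ed]]] := divg _ ge.
have [||b' [r' [c' [c'0 e']]]] := IH d b (q * c); first by rewrite rmorphM mulf_neq0.
  have pi0 : pi != 0.
    by apply: contraTneq (unif_neq0 U) => ->; rewrite rmorph0 eqxx.
  apply: (mulfI pi0); rewrite mulrA.
  have -> : pi * d`_i = q * g`_i.
    by have := congr1 (fun p : {poly T} => p`_i) ed; rewrite !coefCM.
  by rewrite -mulrA e exprS; ring.
exists (q%:P * b'), r'.+1, c'; split=> //.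
have -> : g * (q%:P * b') = pi%:P * (d * b') by rewrite mulrCA mulrA ed -mulrA.
by rewrite rmorphM /= e' -rmorphM /= exprS mulrA.
Qed.

(** A uniformizer is a relation h of least degree for t over the image of K.  The
    degree bounds the divisibility by h. *)
Lemma unif_algebraic (K : fieldType) (L F : fieldType) (ev : {rmorphism K -> L})
    (phi : {rmorphism K -> F}) (s : L) (t : F) :
  injective (evp ev s) -> algebraic_over phi t ->
  exists h, uniformized (evp ev s) (evp phi t) h.
Proof.
move=> inj /(algebraic_minimal (fmorph_inj phi))[h [ht h0 hmin]].
have hs : evp ev s h != 0 by rewrite -(rmorph0 (evp ev s)) (inj_eq inj).
have s1 : (1 < size h)%N.
  rewrite ltnNge; apply: contra h0 => /size1_polyC hE.
  by move/eqP: ht; rewrite hE evpC fmorph_eq0 polyC_eq0.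
have divg g : evp phi t g = 0 -> exists k c, lead_coef h ^+ k *: g = c * h.
  move=> gt; have [k [c [r [rh er /(_ ht) tr]]]] := pseudo_division phi t g h0.
  by exists k, c; rewrite er (hmin r) ?addr0 // -tr gt mulr0.
have l0 k : lead_coef h ^+ k != 0 by rewrite expf_neq0 // lead_coef_eq0.
exists h; split=> //.
- by move=> g; rewrite -[RHS](rmorph0 (evp ev s)) => /inj->; rewrite rmorph0.
- move=> g /divg[k [c e]]; exists (lead_coef h ^+ k)%:P, c.
  by rewrite evpC fmorph_eq0 l0 mul_polyC e mulrC.
move=> g g0.
have {g0} g0 : g != 0 by apply: contraNneq g0 => ->; rewrite rmorph0.
have [n] := ubnP (size g); elim: n => // n IH in g g0 * => sg.
have [gt|gt] := eqVneq (evp phi t g) 0; last first.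
  by exists 1, 0%N, g; rewrite mulr1 expr0 mul1r.
have [k [c e]] := divg _ gt.
have c0 : c != 0.
  apply: contraNneq g0 => c0; move/eqP: e.
  by rewrite c0 mul0r -mul_polyC mulf_eq0 polyC_eq0 (negPf (l0 k)).
have [||b [r [d [d0 ed]]]] := IH c => //.
  have : size (lead_coef h ^+ k *: g) = size g by rewrite size_scale.
  rewrite e size_mul // => sE; rewrite -ltnS (leq_trans _ sg) // -sE.
  by case: (size h) s1 => [//|[//|m]] _; rewrite !addnS /= ltnS ltnS leq_addr.
exists ((lead_coef h ^+ k)%:P * b), r.+1, d; split=> //.
rewrite mulrCA mulrA mul_polyC e -mulrA mulrCA rmorphM /= ed -rmorphM.
by rewrite exprS mulrA.
Qed.

Definition residue_hom (L : fieldType) (v : valuation L) (a : val_ring_type v) :=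
  residue v (val a).

Lemma residue_hom_zmod (L : fieldType) (v : valuation L) :
  zmod_morphism (@residue_hom L v).
Proof.
move=> a b; rewrite /residue_hom; apply/eqP; rewrite eq_sym subr_eq.
rewrite -residueD ?(valP b) ?(valP (a - b)) //.
by rewrite [val (a - b)](rmorphB (val : val_ring_type v -> L)) subrK.
Qed.

Lemma residue_hom_monoid (L : fieldType) (v : valuation L) :
  monoid_morphism (@residue_hom L v).
Proof.
split; first by rewrite /residue_hom (rmorph1 (val : val_ring_type v -> L)) residue1.
move=> a b; rewrite /residue_hom [val (a * b)](rmorphM (val : val_ring_type v -> L)).
by rewrite residueM ?(valP a) ?(valP b).
Qed.

HB.instance Definition _ (L : fieldType) (v : valuation L) :=
  GRing.isZmodMorphism.Build _ _ (@residue_hom L v) (@residue_hom_zmod L v).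
HB.instance Definition _ (L : fieldType) (v : valuation L) :=
  GRing.isMonoidMorphism.Build _ _ (@residue_hom L v) (@residue_hom_monoid L v).

Lemma val_ring_valM (L : fieldType) (v : valuation L) (a b : val_ring_type v) :
  a * b = val_ring_val a * val_ring_val b :> L.
Proof. exact: (rmorphM (val : val_ring_type v -> L)). Qed.

Lemma val_ring_valX (L : fieldType) (v : valuation L) (a : val_ring_type v) n :
  a ^+ n = val_ring_val a ^+ n :> L.
Proof. exact: (rmorphXn (val : val_ring_type v -> L)). Qed.

(** The tautological case of a valuation ring and an element of value 1. *)
Lemma unif_val_ring (K L F : fieldType) (p : valuation K) (j : {rmorphism K -> L})
    (e : {rmorphism residue_field p -> F}) :
  exists pi, uniformized (j \o (val : val_ring_type p -> K)) (e \o @residue_hom K p) pi.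
Proof.
have [x x0 px] := valuation_normalized p.
have xr : x \in val_ring p by rewrite val_ringE px orbT.
pose pi : val_ring_type p := ValRing xr.
have red0 (a : val_ring_type p) :
    (e (residue_hom a) == 0) = (a == 0 :> K) || (1 <= p a).
  by rewrite fmorph_eq0 residue_eq0 ?(valP a).
exists pi; split=> /=.
- by move=> a /eqP; rewrite fmorph_eq0 => /eqP a0; apply/eqP; rewrite red0 a0 eqxx.
- by rewrite fmorph_eq0.
- by apply/eqP; rewrite red0 /= px lexx orbT.
- move=> a /eqP; rewrite red0 => ha.
  have hc : val a / x \in val_ring p.
    rewrite val_ringE mulf_eq0; case: eqVneq ha => //= a0 pa.
    by rewrite valuationM ?invr_eq0 // valuationV // px subr_ge0 pa orbT.
  exists 1, (ValRing hc); rewrite mul1r (rmorph1 (@residue_hom K p)) rmorph1 oner_neq0.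
  have h : val_ring_val (pi * ValRing hc) = val a.
    by rewrite val_ring_valM /= mulrC divfK.
  by split=> //; exact: (congr1 j (esym h)).
move=> a; rewrite fmorph_eq0 => a0.
have := valP a; rewrite val_ringE (negPf a0) /=; case E : (p (val a)) => [n|//] _.
have y0 : val a / x ^+ n != 0 by rewrite mulf_neq0 ?invr_eq0 ?expf_neq0.
have py : p (val a / x ^+ n) = 0.
  rewrite valuationM ?invr_eq0 ?expf_neq0 // valuationV ?expf_neq0 // valuation_exp //.
  by rewrite px E natz subrr.
have yr : val a / x ^+ n \in val_ring p by rewrite val_ringE py lexx orbT.
exists 1, n, (ValRing yr); split.
  by rewrite red0 /= (negPf y0) py.
have h : val_ring_val (pi ^+ n * ValRing yr) = val a.
  by rewrite val_ring_valM val_ring_valX /= mulrC divfK ?expf_neq0.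
by rewrite mulr1; exact: (congr1 j (esym h)).
Qed.

(** * Function fields and their double field *)

Lemma eval_xuE (k L : fieldType) (i : {rmorphism k -> L}) f x u :
  eval_xu i f x u = evp (evp i x) u f.
Proof.
rewrite /eval_xu -[LHS]/(horner_eval x _) -horner_map /= [horner_eval x u%:P]hornerC.
by rewrite evpE -map_poly_comp.
Qed.

Lemma evp2_comp (T L F : comNzRingType) (ev : {rmorphism T -> L})
    (e : {rmorphism L -> F}) s t p :
  evp (evp (e \o ev) (e s)) (e t) p = e (evp (evp ev s) t p).
Proof.
rewrite -evp_comp; apply: eq_evp => q /=; exact: evp_comp.
Qed.

Lemma ker0_injective (T L : comNzRingType) (ev : {rmorphism T -> L}) :
  (forall a, ev a = 0 -> a = 0) -> injective ev.
Proof.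
by move=> h a b e; apply/eqP; rewrite -subr_eq0; apply/eqP/h; rewrite rmorphB e subrr.
Qed.

Lemma transcendental_inj (k L : fieldType) (i : {rmorphism k -> L}) x :
  ~ algebraicOver i x -> injective (evp i x).
Proof.
move=> tx; apply: ker0_injective => p px; apply/eqP; apply/negPn/negP=> p0.
by apply: tx; exists p => //; apply/rootP.
Qed.

Lemma inj_transcendental (k L : fieldType) (i : {rmorphism k -> L}) x :
  injective (evp i x) -> ~ algebraicOver i x.
Proof.
move=> inj [p p0 /rootP px]; case/eqP: p0; apply: inj.
by rewrite rmorph0 -px.
Qed.

Lemma adjoin_sub (k L : fieldType) (i : k -> L) (s : seq L) (P : {pred L}) a :
  divring_closed P -> (forall c, i c \in P) -> {in s, forall y, y \in P} ->
  adjoin i s a -> a \in P.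
Proof. by move=> hP hi hs; apply=> // y [[c ->]|/hs]. Qed.

(** K = k(x, u) with x transcendental and u a simple root of an equation over
    k(x).  The simple root makes the extension K / k(x) unramified. *)
Record separably_generated (k K : fieldType) (i : {rmorphism k -> K}) (x u : K) :
    Prop := SeparablyGenerated {
  sepgen_transcendental : injective (evp i x);
  sepgen_separable : exists f, evp (evp i x) u f = 0 /\ evp (evp i x) u f^`() != 0;
  sepgen_generated : forall a, a \in fracp (evp (evp i x) u) }.

Lemma sepgen_algebraic (k K : fieldType) (i : {rmorphism k -> K}) x u :
  separably_generated i x u -> algebraic_over (evp i x) u.
Proof.
case=> _ [f [fu fu'] _]; exists f => //.
by apply: contraNneq fu' => ->; rewrite deriv0 rmorph0.
Qed.

Lemma natr_neq0_ratext (k : fieldExtType rat) n : (n.+1)%:R != 0 :> k.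
Proof.
by rewrite -[n.+1%:R](rmorph_nat (@GRing.in_alg rat k)) fmorph_eq0 pnatr_eq0.
Qed.

(** In characteristic 0 the derivative of a minimal relation for u is a nonzero
    polynomial of smaller degree, hence does not vanish at u. *)
Lemma generating_sepgen (k : fieldExtType rat) (K : fieldType) (i : {rmorphism k -> K})
    (x u : K) (f : {poly {poly k}}) :
  function_field_in i x -> generating_poly i x u f -> separably_generated i x u.
Proof.
move=> [tx _] [[sf _] fu gen]; have inj := transcendental_inj tx.
rewrite eval_xuE in fu.
have f0 : f != 0 by rewrite -size_poly_gt0 (ltn_trans _ sf).
split=> // [|a]; last first.
  apply: adjoin_sub (gen a); first exact: fracp_divring.
    by move=> c; have := frac_evp_ev (evp i x) u c%:P; rewrite /= evpC.
  move=> y; rewrite !inE => /orP[] /eqP->; last exact: frac_evp_s.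
  by have := frac_evp_ev (evp i x) u 'X; rewrite /= evpX.
have [|h [hu h0 hmin]] := algebraic_minimal inj (s := u); first by exists f.
exists h; split=> //; apply/eqP => hu'.
have h'0 := hmin _ (lt_size_deriv h0) hu'.
have s1 : (1 < size h)%N.
  rewrite ltnNge; apply/negP => /size1_polyC hE.
  move: hu h0; rewrite hE evpC polyC_eq0 => e; rewrite -(rmorph0 (evp i x)) in e.
  by rewrite (inj _ _ e) eqxx.
have := congr1 (fun p : {poly {poly k}} => p`_(size h).-2) h'0.
rewrite coef_deriv coef0 -mulr_natl => /eqP; rewrite mulf_eq0.
rewrite -polyC_natr polyC_eq0 (negPf (natr_neq0_ratext _ _)) /=.
rewrite (_ : (size h).-2.+1 = (size h).-1); last by case: (size h) s1 => [|[]].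
by rewrite -/(lead_coef h) lead_coef_eq0 (negPf h0).
Qed.

Section Lindisj.

Variables (k K K' D : fieldType).
Variables (iK : {rmorphism k -> K}) (iK' : {rmorphism k -> K'}).
Variables (jK : {rmorphism K -> D}) (jK' : {rmorphism K' -> D}).

(** Linear disjointness of K and K' over k, in matrix form: a relation between
    products arises from a matrix M over k with a M = 0 and M b = b, which shows
    that the tensor of the a_i and b_i over k is zero.  The exchange of K and K'
    amounts to replacing M by the transpose of 1 - M, while the usual statement,
    with families independent over k, favours one of the two fields. *)
Definition lindisj : Prop :=
  forall (I : finType) (a : I -> K) (b : I -> K'),
  \sum_i jK (a i) * jK' (b i) = 0 -> exists M : I -> I -> k,
    (forall j, \sum_i iK (M i j) * a i = 0) /\
    (forall i, b i = \sum_j iK' (M i j) * b j).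

Lemma inner_inverse (I J : finType) (C : I -> J -> k) : exists X : J -> I -> k,
  forall i l, C i l = \sum_j (\sum_l' C i l' * X l' j) * C j l.
Proof.
pose A := \matrix_(i < #|I|, j < #|J|) C (enum_val i) (enum_val j).
exists (fun j i => pinvmx A (enum_rank j) (enum_rank i)) => i l.
have := congr1 (fun B : 'M_(_, _) => B (enum_rank i) (enum_rank l)) (mulmxKpV (submx_refl A)).
rewrite !mxE !enum_rankK => <-.
rewrite (reindex_onto enum_rank enum_val) => [|j _]; last exact: enum_valK.
rewrite (eq_bigl xpredT) => [|j]; last by rewrite enum_rankK eqxx.
apply: eq_bigr => j _; rewrite !mxE !enum_rankK; congr (_ * _).
rewrite (reindex_onto enum_rank enum_val) => [|l' _]; last exact: enum_valK.
rewrite (eq_bigl xpredT) => [|l']; last by rewrite enum_rankK eqxx.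
by apply: eq_bigr => l' _; rewrite !mxE !enum_rankK.
Qed.

(** From b = C b' and a C = 0 one gets M = C X, where X is an inner inverse of C,
    one with C X C = C. *)
Lemma tensor_zero (I J : finType) (C : I -> J -> k) (a : I -> K) (b : I -> K') b' :
  (forall j, \sum_i iK (C i j) * a i = 0) ->
  (forall i, b i = \sum_j iK' (C i j) * b' j) ->
  exists M : I -> I -> k, (forall j, \sum_i iK (M i j) * a i = 0) /\
    (forall i, b i = \sum_j iK' (M i j) * b j).
Proof.
move=> ha hb; have [X hX] := inner_inverse C.
exists (fun i j => \sum_l C i l * X l j); split=> [j|i].
  under eq_bigr => i _ do rewrite rmorph_sum mulr_suml.
  rewrite exchange_big big1 // => l _ /=.
  transitivity (iK (X l j) * \sum_i iK (C i l) * a i); last by rewrite ha mulr0.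
  rewrite mulr_sumr; apply: eq_bigr => i _.
  by rewrite rmorphM mulrA [iK _ * _]mulrC.
rewrite hb; under eq_bigr => l _ do rewrite hX rmorph_sum mulr_suml.
rewrite exchange_big; apply: eq_bigr => j _ /=; rewrite hb mulr_sumr.
by apply: eq_bigr => l _; rewrite rmorphM mulrA.
Qed.

End Lindisj.

Lemma lindisj_sym (k K K' D : fieldType)
    (iK : {rmorphism k -> K}) (iK' : {rmorphism k -> K'})
    (jK : {rmorphism K -> D}) (jK' : {rmorphism K' -> D}) :
  lindisj iK iK' jK jK' -> lindisj iK' iK jK' jK.
Proof.
move=> H I b a; under eq_bigr => i _ do rewrite mulrC.
move=> /H[M [hM hM']]; exists (fun i j => (i == j)%:R - M j i); split=> [j|i].
  under eq_bigr => i _ do rewrite rmorphB rmorph_nat mulrBl.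
  rewrite sumrB -hM' (bigD1 j) //= eqxx mul1r big1 ?addr0 ?subrr // => i /negPf->.
  by rewrite mul0r.
under eq_bigr => j _ do rewrite rmorphB rmorph_nat mulrBl.
rewrite sumrB hM subr0 (bigD1 i) //= eqxx mul1r big1 ?addr0 // => j.
by rewrite eq_sym => /negPf->; rewrite mul0r.
Qed.

Lemma coef_size_bound (T : nzRingType) (I : finType) (A : I -> {poly T}) :
  exists N, forall i, (size (A i) <= N)%N.
Proof. by exists (\max_i size (A i)) => i; apply: leq_bigmax. Qed.

Lemma evp2_sum (T L : comNzRingType) (ev : {rmorphism T -> L}) x u (g : {poly {poly T}}) m n :
  (size g <= m)%N -> (forall i : 'I_m, (size (g`_i)%R <= n)%N) ->
  evp (evp ev x) u g = \sum_(il : 'I_m * 'I_n) ev g`_(il.1)`_(il.2) * (x ^+ il.2 * u ^+ il.1).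
Proof.
move=> sm sn; rewrite (evp_sum _ _ sm).
rewrite -(pair_bigA _ (fun (i : 'I_m) (l : 'I_n) => ev g`_i`_l * (x ^+ l * u ^+ i))).
apply: eq_bigr => i _ /=; rewrite (evp_sum _ _ (sn i)) mulr_suml.
by apply: eq_bigr => l _; rewrite mulrA.
Qed.

(** What the arguments below use of the double field; unlike the presentation by
    equations, it is symmetric in K and K'. *)
Record free_compositum (k K K' D : fieldType)
    (iK : {rmorphism k -> K}) (iK' : {rmorphism k -> K'})
    (jK : {rmorphism K -> D}) (jK' : {rmorphism K' -> D})
    (x u : K) (x' u' : K') : Prop := FreeCompositum {
  fc_ground : jK \o iK =1 jK' \o iK';
  fc_sepgen : separably_generated iK x u;
  fc_sepgen' : separably_generated iK' x' u';
  fc_lindisj : lindisj iK iK' jK jK';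
  fc_generated : forall P : {pred D}, divring_closed P ->
    (forall a, jK a \in P) -> (forall b, jK' b \in P) -> forall y, y \in P }.

Lemma free_compositum_sym (k K K' D : fieldType)
    (iK : {rmorphism k -> K}) (iK' : {rmorphism k -> K'})
    (jK : {rmorphism K -> D}) (jK' : {rmorphism K' -> D}) x u x' u' :
  free_compositum iK iK' jK jK' x u x' u' -> free_compositum iK' iK jK' jK x' u' x u.
Proof.
case=> gr sK sK' ld gen; split=> //; first exact: lindisj_sym.
by move=> P hP h h'; apply: gen.
Qed.

Section DoubleField.

Variables (k K K' D : fieldType).
Variables (iK : {rmorphism k -> K}) (iK' : {rmorphism k -> K'}).
Variables (jK : {rmorphism K -> D}) (jK' : {rmorphism K' -> D}).
Variables (x u : K) (x' u' : K').

Section FromDoubleField.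

Hypothesis gr : jK \o iK =1 jK' \o iK'.
Hypothesis sK : separably_generated iK x u.
Hypothesis sK' : separably_generated iK' x' u'.
Hypothesis indep : forall p : {poly {poly k}}, p != 0 ->
  eval_xu (jK \o iK) p (jK x) (jK' x') != 0.

Lemma image_frac a : jK a \in fracp (evp (evp (jK \o iK) (jK x)) (jK u)).
Proof.
have /fracP[p [q [q0 ->]]] := sepgen_generated sK a; rewrite fmorph_div /=.
by rewrite rpred_div // -evp2_comp frac_ev.
Qed.

(** K is finite over k(x).  If x' were algebraic over K, then K(x') would be
    finite over k(x), and x' algebraic over k(x). *)
Lemma transcendental_over_sepgen : injective (evp jK (jK' x')).
Proof.
have inj0 : injective (evp (jK \o iK) (jK x)).
  apply: ker0_injective => p h; apply: (sepgen_transcendental sK); rewrite rmorph0.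
  by apply: (fmorph_inj jK); rewrite -evp_comp h rmorph0.
apply: ker0_injective => p px; apply/eqP; apply/negPn/negP => p0.
have alg : algebraic_over (evp (jK \o iK) (jK x)) (jK u).
  have [f f0 fu] := sepgen_algebraic sK; exists f => //.
  by rewrite evp2_comp fu rmorph0.
have fs := fin_span_evp inj0 alg.
have fs' : fin_span jK (fracp (evp jK (jK' x'))).
  by apply: fin_span_evp; [exact: fmorph_inj | exists p].
have sub : {subset fracp jK <= fracp (evp (evp (jK \o iK) (jK x)) (jK u))}.
  by apply: frac_sub => a; apply: image_frac.
have [n|q q0 qx] := fin_span_algebraic (y := jK' x') (fin_span_trans fs sub fs').
  by rewrite rpredX ?frac_evp_s.
by have := indep q0; rewrite eval_xuE qx eqxx.
Qed.

(** Write b_i = g_i(x', u') / d(x') with g_i over k of degree less than that of f'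
    in u'.  A relation sum a_i b_i = 0 says that the polynomial sum a_i g_i over
    K[x'] vanishes at u'.  Since f' stays irreducible over K(x'), this polynomial
    is zero, and its coefficients are relations over k between the a_i. *)
Lemma irreducible_lindisj (f' : {poly {poly k}}) :
  evp (evp iK' x') u' f' = 0 -> irreducible_poly (map_poly (map_poly iK) f') ->
  lindisj iK iK' jK jK'.
Proof.
move=> f'u [sf irr] I a b hab; set fK := map_poly (map_poly iK) f' in sf irr.
have injm : injective (map_poly iK).
  by apply: ker0_injective => p /eqP; rewrite (map_ev_eq0 (fmorph_inj iK)) => /eqP.
have sff : size fK = size f' by rewrite size_map_inj_poly ?rmorph0.
have f'0 : f' != 0 by rewrite -size_poly_gt0 -sff ltnW.
pose evK := evp jK (jK' x').
have evKE : evK \o map_poly iK =1 jK' \o evp iK' x'.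
  move=> p /=; rewrite /evK evp_map -evp_comp; exact: eq_evp.
have evKE2 g : evp evK (jK' u') (map_poly (map_poly iK) g) = jK' (evp (evp iK' x') u' g).
  by rewrite evp_map -evp_comp; apply: eq_evp.
(* by irreducibility, f' is itself a relation of least degree over K[x'] *)
have minf (P : {poly {poly K}}) : (size P < size f')%N -> evp evK (jK' u') P = 0 -> P = 0.
  have [|h [hu h0 hmin]] := algebraic_minimal transcendental_over_sepgen (s := jK' u').
    exists fK; first by rewrite -size_poly_gt0 ltnW.
    by rewrite evKE2 f'u rmorph0.
  have [j [c [r [rh er /(_ hu) tr]]]] := pseudo_division evK (jK' u') fK h0.
  have r0 : r = 0 by apply: hmin => //; rewrite -tr evKE2 f'u rmorph0 mulr0.
  have hf : h %| fK.
    apply/Pdiv.Idomain.dvdpP; exists (lead_coef h ^+ j, c) => /=.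
      by rewrite expf_neq0 // lead_coef_eq0.
    by rewrite er r0 addr0.
  have sh : size h != 1%N.
    apply/negP=> /size_poly1P[d d0 hE]; move: hu; rewrite hE evpC => e.
    by case/eqP: d0; apply: transcendental_over_sepgen; rewrite rmorph0.
  by move=> sP Pu; apply: hmin Pu; rewrite (eqp_size (irr h sh hf)) sff.
set n := (size f').-1.
have /choice[c hc] i : exists c : 'I_n -> K',
    (forall l, c l \in fracp (evp iK' x')) /\ b i = \sum_l c l * u' ^+ l.
  have [c h1 h2] := frac_evp_coefs (sepgen_transcendental sK') f'0 f'u (sepgen_generated sK' (b i)).
  by exists c.
have [[i l]|d [A [d0 hA]]] :=
    @common_denominator _ _ (evp iK' x') (I * 'I_n)%type (fun il => c il.1 il.2).
  by case: (hc i).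
have bE i : evp iK' x' d * b i = \sum_l evp iK' x' (A (i, l)) * u' ^+ l.
  have [_ ->] := hc i; rewrite mulr_sumr; apply: eq_bigr => l _.
  by rewrite (hA (i, l)) mulrA [evp _ _ d * _]mulrC divfK.
pose g i : {poly {poly k}} := rVpoly (\row_l A (i, l)).
have sg i : (size (g i) <= n)%N by apply: size_poly.
have gE i (l : 'I_n) : (g i)`_l = A (i, l) by rewrite coef_rVpoly_ord mxE.
have gb i : evp (evp iK' x') u' (g i) = evp iK' x' d * b i.
  by rewrite bE (evp_sum _ _ (sg i)); apply: eq_bigr => l _; rewrite gE.
pose P := \sum_i (a i)%:P%:P * map_poly (map_poly iK) (g i).
have P0 : P = 0.
  apply: minf.
    rewrite -[ltnRHS]prednK ?size_poly_gt0 // ltnS.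
    apply: (leq_trans (size_sum _ _ _)); apply/bigmax_leqP => i _.
    apply: leq_trans (sg i); rewrite mul_polyC; apply: leq_trans (size_scale_leq _ _) _.
    exact: size_poly.
  rewrite rmorph_sum /=.
  transitivity (jK' (evp iK' x' d) * \sum_i jK (a i) * jK' (b i)); last by rewrite hab mulr0.
  rewrite mulr_sumr; apply: eq_bigr => i _.
  rewrite rmorphM /= [evp _ _ _%:P]evpC /=.
  by rewrite evpC evKE2 gb rmorphM mulrCA.
have [N hN] := coef_size_bound A.
apply: (tensor_zero (C := fun i (lm : 'I_n * 'I_N) => (g i)`_(lm.1)`_(lm.2))
   (b' := fun lm : 'I_n * 'I_N => x' ^+ lm.2 * u' ^+ lm.1 / evp iK' x' d)) => [[l m]|i] /=.
  transitivity (P`_l`_m); last by rewrite P0 !coef0.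
  rewrite coef_sum coef_sum; apply: eq_bigr => i _.
  by rewrite coefCM coefCM !coef_map /= mulrC.
apply: (mulfI d0); rewrite -gb (@evp2_sum _ _ _ _ _ _ n N) //; last first.
  by move=> l; rewrite gE.
rewrite mulr_sumr; apply: eq_bigr => lm _.
by rewrite [RHS]mulrCA [evp _ _ d * _]mulrC divfK.
Qed.

End FromDoubleField.

Hypothesis H : free_compositum iK iK' jK jK' x u x' u'.

(** A relation sum p_i x'^i = 0 comes from a matrix M with M b = b for the vector
    b of the powers of x'.  These are independent over k, so M = 1 and p = p M = 0. *)
Lemma fc_transcendental' : injective (evp jK (jK' x')).
Proof.
apply: ker0_injective => p px.
have [|M [hM hM']] := fc_lindisj H (a := fun i : 'I_(size p) => p`_i)
    (b := fun i : 'I_(size p) => x' ^+ i).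
  rewrite -[X in _ = X]px [X in _ = X](evp_sum _ _ (leqnn _)).
  by apply: eq_bigr => i _; rewrite rmorphXn.
have ME i j : M i j = (i == j)%:R.
  pose q : {poly k} := 'X^i - rVpoly (\row_l M i l).
  have sq : (size q <= size p)%N.
    rewrite (leq_trans (size_polyD _ _)) // geq_max size_polyXn ltn_ord size_polyN.
    exact: size_poly.
  have q0 : q = 0.
    apply: (sepgen_transcendental (fc_sepgen' H)); rewrite rmorph0 rmorphB rmorphXn /= evpX.
    apply/eqP; rewrite subr_eq0 hM'; apply/eqP.
    rewrite [RHS](@evp_sum _ _ _ _ (size p)) ?size_poly //.
    by apply: eq_bigr => l _; rewrite coef_rVpoly_ord mxE.
  have := congr1 (fun q : {poly k} => q`_j) q0.
  rewrite coef0 coefB coefXn coef_rVpoly_ord mxE => /eqP; rewrite subr_eq0 => /eqP <-.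
  by rewrite eq_sym.
have p0 (j : 'I_(size p)) : p`_j = 0.
  transitivity (\sum_i iK (M i j) * p`_i); last exact: hM.
  rewrite (bigD1 j) //= ME eqxx rmorph1 mul1r big1 ?addr0 // => i ij.
  by rewrite ME (negPf ij) rmorph0 mul0r.
apply/polyP=> j; rewrite coef0; have [jp|/leq_sizeP->//] := ltnP j (size p).
exact: (p0 (Ordinal jp)).
Qed.

Section WellDefined.

Variables (O : idomainType) (F : fieldType).
Variables (ev : {rmorphism O -> K}) (mu : {rmorphism O -> F}) (g' : {rmorphism K' -> F}).
Hypothesis ev_inj : injective ev.
Hypothesis ground : forall c, exists2 o, ev o = iK c & mu o = g' (iK' c).

(** The homomorphisms on O and K' glue: by [lindisj] a relation in D is a
    consequence of relations over k, which both homomorphisms respect. *)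
Lemma fc_well_defined (g : {poly {poly O}}) :
  evp (evp (jK \o ev) (jK' x')) (jK' u') g = 0 ->
  evp (evp mu (g' x')) (g' u') g = 0.
Proof.
have [N hN] := coef_size_bound (fun i : 'I_(size g) => g`_i).
rewrite !(@evp2_sum _ _ _ _ _ _ (size g) N) //= => h.
pose a (il : 'I_(size g) * 'I_N) := g`_(il.1)`_(il.2).
pose b (il : 'I_(size g) * 'I_N) := x' ^+ il.2 * u' ^+ il.1.
have [|M [hM hM']] := fc_lindisj H (a := fun i => ev (a i)) (b := b).
  transitivity (\sum_i jK (ev (a i)) * (jK' x' ^+ i.2 * jK' u' ^+ i.1)); last exact: h.
  by apply: eq_bigr => i _; rewrite rmorphM !rmorphXn.
transitivity (\sum_i mu (a i) * g' (b i)).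
  by apply: eq_bigr => i _; rewrite rmorphM !rmorphXn.
under eq_bigr => i _ do rewrite hM' rmorph_sum mulr_sumr.
rewrite exchange_big big1 // => j _ /=.
have /choice[o ho] c : exists o, ev o = iK c /\ mu o = g' (iK' c).
  by have [o h1 h2] := ground c; exists o.
transitivity (mu (\sum_i o (M i j) * a i) * g' (b j)).
  rewrite rmorph_sum mulr_suml; apply: eq_bigr => i _.
  by rewrite !rmorphM /= (ho _).2 mulrCA mulrA.
suff -> : \sum_i o (M i j) * a i = 0 by rewrite rmorph0 mul0r.
apply: ev_inj; rewrite rmorph0.
transitivity (\sum_i iK (M i j) * ev (a i)); last exact: hM.
rewrite rmorph_sum; apply: eq_bigr => i _.
by rewrite rmorphM /= (ho _).1.
Qed.

End WellDefined.
End DoubleField.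

(** * Algebraic dependence in function fields *)

Lemma evp2_swap (k L : fieldType) (i : {rmorphism k -> L}) x y q :
  evp (evp i x) y (swapXY q) = evp (evp i y) x q.
Proof. by rewrite -!eval_xuE /eval_xu -swapXY_map horner2_swapXY. Qed.

Lemma function_field_fin_span (k L : fieldType) (i : {rmorphism k -> L}) x :
  function_field_in i x -> fin_span (evp i x) predT.
Proof.
move=> [_ [n [b hb]]]; exists 'I_n, b => y _; have [c hc ->] := hb y.
exists c => // r; apply: adjoin_sub (hc r); first exact: fracp_divring.
  by move=> a; apply: frac_evp_ev.
by move=> z; rewrite inE => /eqP->; apply: frac_evp_s.
Qed.

(** The exchange property: y is algebraic over k(x), and its equation, read as an
    equation for x, shows that x is algebraic over k(y). *)
Lemma function_field_exchange (k L : fieldType) (i : {rmorphism k -> L}) x y :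
  function_field_in i x -> injective (evp i y) -> fin_span (evp i y) predT.
Proof.
move=> hx inj; have fs := function_field_fin_span hx.
have [//|q q0 qy] := fin_span_algebraic (y := y) fs.
have alg : algebraic_over (evp i y) x.
  by exists (swapXY q); rewrite ?swapXY_eq0 // evp2_swap.
apply: (fin_span_trans (fin_span_evp inj alg) _ fs).
apply: frac_evp_sub; last exact: frac_evp_s.
by move=> a; have := frac_evp_ev (evp i y) x a%:P; rewrite /= evpC.
Qed.

Lemma function_field_dependent (k L : fieldType) (i : {rmorphism k -> L}) x y z :
  function_field_in i x -> injective (evp i y) -> algebraic_over (evp i y) z.
Proof. by move=> hx /(function_field_exchange hx)/fin_span_algebraic; apply. Qed.

Lemma divisible_by_X (T : nzRingType) (p : {poly T}) : p`_0 = 0 -> exists q, p = q * 'X.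
Proof.
elim/poly_ind: p => [|p c _]; first by exists 0; rewrite mul0r.
rewrite coefD coefMX coefC add0r /= => ->; exists p; by rewrite addr0.
Qed.

Lemma split_constant (T : nzRingType) (p : {poly T}) : exists q, p = q * 'X + (p`_0)%:P.
Proof.
have [|q e] := @divisible_by_X _ (p - (p`_0)%:P); first by rewrite coefB coefC subrr.
by exists q; rewrite -e subrK.
Qed.

Lemma map_poly_neq0 (T L : nzRingType) (ev : {rmorphism T -> L}) p :
  injective ev -> p != 0 -> map_poly ev p != 0.
Proof.
move=> inj; rewrite -[X in _ -> _ != X](rmorph0 (map_poly ev)) inj_eq //.
exact: map_inj_poly inj (rmorph0 ev).
Qed.

(** The largest power of X that divides all members of a family of polynomials is
    factored out.  It serves to reduce relations modulo an element z that is
    substituted for X: divided by that power of z, they stay non-trivial modulo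
    z. *)
Lemma strip_power_of_X (T : nzRingType) (I : finType) (C : I -> {poly T}) :
  (exists i, C i != 0) -> exists s C', (forall i, C i = C' i * 'X^s) /\
    exists i, (C' i)`_0 != 0.
Proof.
case=> i0 Ci0; have [n] := ubnP (size (C i0)).
elim: n => // n IH in C Ci0 *; rewrite ltnS => sC.
have [h|h] := pselect (exists i, (C i)`_0 != 0).
  by exists 0%N, C; split=> // i; rewrite expr0 mulr1.
have /choice[C' hC'] i : exists q, C i = q * 'X.
  apply: divisible_by_X; apply/eqP/negPn/negP => ci; apply: h; by exists i.
have C'0 : C' i0 != 0 by apply: contraNneq Ci0 => e; rewrite hC' e mul0r.
have [|s [C'' [hC'' h'']]] := IH C' C'0.
  by rewrite -ltnS (leq_trans _ (leq_ltn_trans sC (ltnSn _))) // hC' size_mulX.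
by exists s.+1, C''; split=> // i; rewrite hC' hC'' -mulrA exprSr.
Qed.

Lemma evp0 (T L : comNzRingType) (ev : {rmorphism T -> L}) p : evp ev 0 p = ev p`_0.
Proof. by rewrite evpE horner_coef0 coef_map. Qed.

(** A linearly independent family with the largest possible number of members is
    a basis. *)
Lemma fin_span_of_dependence (T : idomainType) (L : fieldType) (ev : {rmorphism T -> L}) N :
  injective ev ->
  (forall (I : finType) (y : I -> L), (N < #|I|)%N ->
    exists2 v : I -> T, (exists i, v i != 0) & \sum_i ev (v i) * y i = 0) ->
  fin_span ev predT.
Proof.
move=> inj dep.
pose indep (I : finType) (y : I -> L) :=
  forall v : I -> T, \sum_i ev (v i) * y i = 0 -> forall i, v i = 0.
pose P n := `[< exists (I : finType) (y : I -> L), #|I| = n /\ indep I y >].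
have exP : exists n, P n.
  by exists 0%N; apply/asboolP; exists void, (fun _ => 0); rewrite card_void; split=> // v _ [].
have leP n : P n -> (n <= N)%N.
  move=> /asboolP[I [y [<- h]]]; rewrite leqNgt; apply/negP => NI.
  have [v [i vi] /h e] := dep I y NI; by rewrite e eqxx in vi.
case: (ex_maxnP exP leP) => n /asboolP[I [b [cI hb]]] nmax.
exists I, b => y _.
(* b with y adjoined *)
pose b' (o : option I) := if o is Some i then b i else y.
have [h|] := pselect (indep _ b').
  have /nmax : P n.+1 by apply/asboolP; exists (option I), b'; rewrite card_option cI.
  by rewrite ltnn.
move=> /existsNP[v /not_implyP[hv /existsNP[o vo]]].
rewrite (bigD1 None) //= (reindex_omap Some id) /= in hv; last by case.
rewrite (eq_bigl xpredT) in hv; last by move=> i; rewrite /= eqxx.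
have v0 : v None != 0.
  apply/negP => /eqP v0; case: vo; case: o => [i|//].
  by apply: (hb (fun i => v (Some i))); rewrite -[RHS]hv v0 rmorph0 mul0r add0r.
have ev0 : ev (v None) != 0 by rewrite -(rmorph0 ev) (inj_eq inj).
exists (fun i => - (ev (v (Some i)) / ev (v None))).
  by move=> i; rewrite rpredN rpred_div ?frac_ev.
apply: (mulfI ev0); rewrite mulr_sumr.
transitivity (- \sum_i ev (v (Some i)) * b i).
  by apply/eqP; rewrite -addr_eq0 hv.
rewrite -sumrN; apply: eq_bigr => i _.
by rewrite mulNr mulrN mulrA [ev (v None) * _]mulrC divfK.
Qed.

Lemma frac_adjoin (k L : fieldType) (i : {rmorphism k -> L}) x y :
  y \in fracp (evp i x) -> adjoin i [:: x] y.
Proof.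
move=> /fracP[a [b [b0 ->]]] P hP hA.
pose PS : divringClosed L := HB.pack P (GRing.isDivringClosed.Build _ P hP).
have hx : x \in (PS : {pred L}) by apply: hA; right; rewrite inE.
have hi c : i c \in (PS : {pred L}) by apply: hA; left; exists c.
have hev p : evp i x p \in (PS : {pred L}).
  rewrite (evp_sum _ _ (leqnn _)) rpred_sum // => j _.
  by rewrite rpredM ?rpredX.
exact: (rpred_div (hev a) (hev b)).
Qed.

Lemma fin_span_finite_over (k L : fieldType) (i : {rmorphism k -> L}) x :
  fin_span (evp i x) predT -> finite_over (adjoin i [:: x]).
Proof.
move=> [I [b hb]]; exists #|I|, (fun r => b (enum_val r)) => y.
have [c hc ->] := hb y isT; exists (fun r => c (enum_val r)).
  by move=> r; apply: frac_adjoin.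
rewrite (reindex_onto enum_val enum_rank) => [|l' _]; last exact: enum_rankK.
by apply: eq_bigl => j; rewrite enum_valK eqxx.
Qed.

(** * The residue field of a prime divisor of the double field *)

Lemma trivial_val_ring (E L : fieldType) (j : {rmorphism E -> L}) (m : valuation L) a :
  trivial_on j m -> j a \in val_ring m.
Proof.
move=> tr; rewrite val_ringE; have [->|a0] := eqVneq a 0; first by rewrite rmorph0 eqxx.
by rewrite tr // lexx orbT.
Qed.

Lemma trivial_residue (E L : fieldType) (j : {rmorphism E -> L}) (m : valuation L) :
  trivial_on j m -> exists g : {rmorphism E -> residue_field m},
    forall a, g a = residue m (j a).
Proof.
move=> tr; pose g a := residue m (j a).
have gB : zmod_morphism g.
  move=> a b; apply/eqP; rewrite eq_sym subr_eq /g -residueD ?trivial_val_ring //.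
  by rewrite -rmorphD subrK.
have gM : monoid_morphism g.
  split; first by rewrite /g rmorph1 residue1.
  by move=> a b; rewrite /g rmorphM residueM ?trivial_val_ring.
pose gr : {rmorphism E -> residue_field m} := HB.pack g
  (GRing.isZmodMorphism.Build _ _ g gB) (GRing.isMonoidMorphism.Build _ _ g gM).
by exists gr.
Qed.

Lemma evp_residue (T : comNzRingType) (L : fieldType) (m : valuation L)
    (ev : {rmorphism T -> L}) (phi : {rmorphism T -> residue_field m}) s p :
  (forall a, ev a \in val_ring m) -> (forall a, residue m (ev a) = phi a) ->
  s \in val_ring m ->
  evp ev s p \in val_ring m /\ residue m (evp ev s p) = evp phi (residue m s) p.
Proof.
move=> hev hphi hs.
apply: (@evp_rel _ _ _ ev phi (fun y z => y \in val_ring m /\ residue m y = z)) => //.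
- by move=> a b c d [ha <-] [hb <-]; rewrite rpredD // residueD.
- by move=> a b c d [ha <-] [hb <-]; rewrite rpredM // residueM.
Qed.

Lemma linear_unit_neq0 (T : nzRingType) (a : T) : a%:P * 'X - 1 != 0 :> {poly T}.
Proof.
apply/eqP => /(congr1 (fun p : {poly T} => p`_0)) /eqP.
by rewrite coefB coefMX coef1 coef0 sub0r oppr_eq0 oner_eq0.
Qed.

Lemma generic_difference_neq0 (T : nzRingType) (c : {poly T}) :
  map_poly polyC c - 'X%:P != 0.
Proof.
apply/eqP => /(congr1 (fun p : {poly {poly T}} => p`_0)) /eqP.
rewrite coefB coef_map coefC coef0 subr_eq0 /= => /eqP/(congr1 (fun p : {poly T} => size p)).
by rewrite size_polyX => h; have := size_polyC_leq1 c`_0; rewrite h.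
Qed.

Section ResidueFunctionField.

Variables (k K K' D : fieldType).
Variables (iK : {rmorphism k -> K}) (iK' : {rmorphism k -> K'}).
Variables (jK : {rmorphism K -> D}) (jK' : {rmorphism K' -> D}).
Variables (x u : K) (x' u' : K').
Hypothesis H : free_compositum iK iK' jK jK' x u x' u'.

Local Notation ev_x' := (evp (jK' \o iK') (jK' x')).
Local Notation ev_xx := (evp ev_x' (jK x)).

Lemma image_frac' b : jK' b \in fracp (evp ev_x' (jK' u')).
Proof. exact: image_frac (fc_sepgen' H) b. Qed.

Let groundE c : jK (iK c) = jK' (iK' c).
Proof. exact: fc_ground H c. Qed.

Lemma ev_xx_inj : injective ev_xx.
Proof.
have injx := fc_transcendental' (free_compositum_sym H).
apply: ker0_injective => p h.
have /eqP : map_poly (evp iK' x') p = 0.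
  apply: injx; rewrite rmorph0 evp_map -h; apply: eq_evp => q /=.
  by rewrite -evp_comp.
by rewrite (map_ev_eq0 (sepgen_transcendental (fc_sepgen' H))) => /eqP.
Qed.

(** D is generated in three steps: x' and x are independent over k, u is algebraic
    over k(x', x), and u' is algebraic over K(x').  Each step uses a ring of
    independent elements as its base, so that evaluation is injective. *)
Lemma fin_span_xx : fin_span ev_xx predT.
Proof.
have algu : algebraic_over ev_xx (jK u).
  have [f f0 fu] := sepgen_algebraic (fc_sepgen H); exists (map_poly (map_poly polyC) f).
    by apply: map_poly_neq0 f0; apply: map_inj_poly (rmorph0 _); apply: polyC_inj.
  rewrite evp_map -[RHS](rmorph0 jK) -fu -evp_comp; apply: eq_evp => q /=.
  rewrite evp_map -evp_comp; apply: eq_evp => c /=.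
  by rewrite evpC /= groundE.
have fs1 := fin_span_evp ev_xx_inj algu.
have evC q : evp ev_xx (jK u) q%:P = ev_xx q by rewrite evpC.
set V1 := fracp _ in fs1.
have V1x' : jK' x' \in V1.
  by have := frac_ev (evp ev_xx (jK u)) 'X%:P%:P; rewrite /= evpC /= evpC /= evpX.
have V1k c : jK' (iK' c) \in V1.
  by have := frac_ev (evp ev_xx (jK u)) c%:P%:P%:P; rewrite /= evpC /= evpC /= evpC.
have V1x : jK x \in V1.
  by have := frac_ev (evp ev_xx (jK u)) 'X%:P; rewrite /= evpC /= evpX.
have V1u : jK u \in V1 by apply: frac_evp_s.
have V1K a : jK a \in V1.
  have s0 : {subset fracp (evp (jK \o iK) (jK x)) <= V1}.
    by apply: frac_evp_sub => // c /=; rewrite groundE; apply: V1k.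
  have s1 : {subset fracp (evp (evp (jK \o iK) (jK x)) (jK u)) <= V1}.
    by apply: frac_evp_sub => // p; apply/s0/frac_ev.
  exact: s1 (image_frac jK (fc_sepgen H) a).
have algu' : algebraic_over (evp jK (jK' x')) (jK' u').
  have [f f0 fu] := sepgen_algebraic (fc_sepgen' H); exists (map_poly (map_poly iK) f).
    by apply: map_poly_neq0 f0; apply: map_inj_poly (rmorph0 _); apply: fmorph_inj.
  rewrite evp_map -[RHS](rmorph0 jK') -fu -evp_comp; apply: eq_evp => q /=.
  rewrite evp_map -evp_comp; apply: eq_evp => c; exact: (fc_ground H c).
have fs2 := fin_span_evp (fc_transcendental' H) algu'.
have sub : {subset fracp (evp jK (jK' x')) <= V1} by apply: frac_evp_sub.
apply: fin_span_sub (fin_span_trans fs1 sub fs2) => y _.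
apply: (fc_generated H) => [|a|b]; first exact: fracp_divring.
  by have := frac_ev (evp (evp jK (jK' x')) (jK' u')) a%:P%:P; rewrite /= evpC /= evpC.
set V2 := fracp _.
have V2x' : jK' x' \in V2.
  by have := frac_ev (evp (evp jK (jK' x')) (jK' u')) 'X%:P; rewrite /= evpC /= evpX.
have s0 : {subset fracp ev_x' <= V2}.
  apply: frac_evp_sub => // c /=; rewrite -groundE.
  by have := frac_ev (evp (evp jK (jK' x')) (jK' u')) (iK c)%:P%:P; rewrite /= evpC /= evpC.
have s1 : {subset fracp (evp ev_x' (jK' u')) <= V2}.
  by apply: frac_evp_sub => [p|]; [apply/s0/frac_ev | exact: frac_evp_s].
exact: s1 (image_frac' b).
Qed.

Variable m : valuation D.
Hypothesis tr : trivial_on jK' m.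

Lemma ev_x'_residue : exists phi : {rmorphism {poly k} -> residue_field m},
  injective phi /\ forall p, ev_x' p \in val_ring m /\ residue m (ev_x' p) = phi p.
Proof.
have [g hg] := trivial_residue tr.
exists (g \o evp iK' x'); split.
  by apply: inj_comp; [exact: fmorph_inj | exact: sepgen_transcendental (fc_sepgen' H)].
by move=> p /=; rewrite evp_comp hg trivial_val_ring.
Qed.

(** The element z makes x algebraic over k(x', z).  If x is not integral, then
    z = 1/x.  Otherwise take an element pi of value 1; it is algebraic over
    k(x', x), and z is the constant term of an equation for pi, which is a
    multiple of pi and a polynomial in x', x. *)
Lemma exists_parameter : exists z, [/\ z != 0, z \in val_ring m, residue m z = 0
  & algebraic_over (evp ev_x' z) (jK x)].
Proof.
have [xr|xr] := boolP (jK x \in val_ring m); last first.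
  have [x0 xV rV] := val_ring_inverse xr; exists (jK x)^-1; split=> //.
    by rewrite invr_eq0.
  exists ('X%:P * 'X - 1); last first.
    by rewrite rmorphB rmorphM rmorph1 /= evpX evpC /= evpX mulVf ?subrr.
  exact: linear_unit_neq0.
have [phi [phi_inj hphi]] := ev_x'_residue.
have [pi pi0 mpi] := valuation_normalized m.
have pir : pi \in val_ring m by rewrite val_ringE mpi orbT.
have rpi : residue m pi = 0 by apply/eqP; rewrite residue_eq0P ?mpi.
have [//|q q0 qpi] := fin_span_algebraic (y := pi) fin_span_xx.
have [|s [C [hC [[] C0]]]] := strip_power_of_X (C := fun _ : unit => q).
  by exists tt.
move: {hC C} (C tt) (hC tt) C0 => q' qE q'0.
have {}qpi : evp ev_xx pi q' = 0.
  move/eqP: qpi; rewrite qE rmorphM rmorphXn /= evpX mulf_eq0 expf_eq0 (negPf pi0).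
  by rewrite andbF orbF => /eqP.
have [d q'E] := split_constant q'; set c := q'`_0 in q'0 q'E.
have cE : ev_xx c = - evp ev_xx pi d * pi.
  apply/eqP; rewrite mulNr -addr_eq0 addrC; apply/eqP.
  by rewrite -qpi q'E rmorphD rmorphM /= evpX evpC.
have ev_xxV a : ev_xx a \in val_ring m /\ residue m (ev_xx a) = evp phi (residue m (jK x)) a.
  by apply: evp_residue => // b; case: (hphi b).
have dV : evp ev_xx pi d \in val_ring m.
  have h a : ev_xx a \in val_ring m by case: (ev_xxV a).
  have h' a : residue m (ev_xx a) = evp phi (residue m (jK x)) a by case: (ev_xxV a).
  by have [] := evp_residue d h h' pir.
exists (ev_xx c); split.
- by rewrite -(rmorph0 ev_xx) (inj_eq ev_xx_inj).
- by case: (ev_xxV c).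
- by rewrite cE residueM ?rpredN // rpi mulr0.
exists (map_poly polyC c - 'X%:P); last first.
  rewrite rmorphB /= evpC /= evpX evp_map; apply/eqP; rewrite subr_eq0; apply/eqP.
  by apply: eq_evp => a /=; rewrite evpC.
exact: generic_difference_neq0.
Qed.

(** Let z be as in [exists_parameter], so that D is finite over k(x', z).  Lift a
    large family of residues to D.  A linear relation between the lifts over
    k[x', z], divided by the largest possible power of z, has a non-trivial
    reduction, which is a linear relation over k[x'] between the residues. *)
Lemma residue_function_field :
  exists iF : {rmorphism k -> residue_field m},
    (forall c, iF c = residue m (jK' (iK' c))) /\
    function_field_in iF (residue m (jK' x')).
Proof.
have [g hg] := trivial_residue tr.
exists (g \o iK'); split=> [c|]; first by rewrite -hg.
have xE : residue m (jK' x') = g x' by rewrite hg.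
have inj : injective (evp (g \o iK') (residue m (jK' x'))).
  apply: ker0_injective => p /=; rewrite xE evp_comp => /eqP; rewrite fmorph_eq0 => /eqP h.
  by apply: (sepgen_transcendental (fc_sepgen' H)); rewrite h rmorph0.
split; first exact: inj_transcendental.
apply: fin_span_finite_over.
set phi := evp _ _ in inj *.
have hphi p : ev_x' p \in val_ring m /\ residue m (ev_x' p) = phi p.
  by rewrite evp_comp trivial_val_ring // -hg /phi xE evp_comp.
have [z [z0 zV rz algx]] := exists_parameter.
have hz p : evp ev_x' z p \in val_ring m /\ residue m (evp ev_x' z p) = phi p`_0.
  have h a : ev_x' a \in val_ring m by case: (hphi a).
  have h' a : residue m (ev_x' a) = phi a by case: (hphi a).
  by have [-> ->] := evp_residue p h h' zV; rewrite rz evp0.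
have injz : injective (evp ev_x' z).
  apply: ker0_injective => p pz; apply/eqP/negPn/negP => p0.
  have [|s [C [hC [[] C0]]]] := strip_power_of_X (C := fun _ : unit => p); first by exists tt.
  move/eqP: pz; rewrite (hC tt) rmorphM rmorphXn /= evpX mulf_eq0 expf_eq0 (negPf z0).
  rewrite andbF orbF => /eqP Cz; have [_] := hz (C tt); rewrite Cz residue0 => /esym h.
  by case/eqP: C0; apply: inj; rewrite h /phi rmorph0.
have fs1 := fin_span_evp injz algx.
have sub : {subset fracp ev_xx <= fracp (evp (evp ev_x' z) (jK x))}.
  apply: frac_evp_sub; last exact: frac_evp_s.
  by move=> p; have := frac_ev (evp (evp ev_x' z) (jK x)) p%:P%:P; rewrite /= evpC /= evpC.
have [N hN] := fin_span_dependent (fin_span_trans fs1 sub fin_span_xx).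
apply: (@fin_span_of_dependence _ _ _ N) => // I y NI.
have /choice[b hb] i : exists b, b \in val_ring m /\ residue m b = y i.
  by have [b h1 h2] := residue_surj (y i); exists b.
have [//|v v0 hv] := hN I b NI.
have [s [C [hC C0]]] := strip_power_of_X v0.
exists (fun i => (C i)`_0) => //.
have hC' : \sum_i evp ev_x' z (C i) * b i = 0.
  apply: (mulfI (expf_neq0 s z0)); rewrite mulr0 mulr_sumr.
  transitivity (\sum_i evp ev_x' z (v i) * b i); last exact: hv.
  by apply: eq_bigr => i _; rewrite hC rmorphM rmorphXn /= evpX mulrA [z ^+ s * _]mulrC.
pose Q (a : D) (r : residue_field m) := a \in val_ring m /\ residue m a = r.
have QS : Q (\sum_i evp ev_x' z (C i) * b i) (\sum_i phi (C i)`_0 * y i).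
  apply: (big_ind2 Q) => [|a r a' r' [ha <-] [ha' <-]|i _].
  - by rewrite /Q rpred0 residue0.
  - by rewrite /Q rpredD // residueD.
  have [h1 h2] := hz (C i); have [h3 h4] := hb i.
  by rewrite /Q rpredM // residueM // h2 h4.
by case: QS => _ <-; rewrite hC' residue0.
Qed.

End ResidueFunctionField.

(** * Restriction of a valuation to a subfield *)

(** The values on E form a subgroup of the integers, generated by its least
    positive element c. *)
Lemma valuation_restriction (E L : fieldType) (j : {rmorphism E -> L}) (m : valuation L) :
  ~ trivial_on j m -> exists (p : valuation E) (c : int),
    0 < c /\ forall a, a != 0 -> m (j a) = p a * c.
Proof.
move=> /existsNP[a0 /not_implyP[a00 ma0]].
pose P (n : nat) := `[< (0 < n)%N /\ exists2 a, a != 0 & m (j a) = n >].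
have exP : exists n, P n.
  have [a [a1 ha]] : exists a, a != 0 /\ 0 < m (j a).
    have [h|h] := ltP 0 (m (j a0)); first by exists a0.
    exists a0^-1; rewrite invr_eq0 fmorphV valuationV ?fmorph_eq0 //; split=> //.
    by rewrite oppr_gt0 lt_neqAle h andbT; apply/eqP.
  exists `|m (j a)|%N; apply/asboolP; split; first by rewrite absz_gt0 gt_eqF.
  by exists a => //; rewrite gtz0_abs.
case: (ex_minnP exP) => n /asboolP[n0 [b b0 mb]] nmin.
have jn a : a != 0 -> j a != 0 by rewrite fmorph_eq0.
have hm a q : a != 0 -> m (j (a * b ^ q)) = m (j a) + q * n%:Z.
  move=> a1; have bq : j (b ^ q) != 0 by rewrite fmorph_eq0 expfz_neq0.
  rewrite rmorphM (valuationM m (jn _ a1) bq); congr (_ + _).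
  case: q bq => q bq; first by rewrite -exprnP rmorphXn valuation_exp ?jn // mb -mulr_natl natz.
  rewrite NegzE -exprnN fmorphV rmorphXn valuationV ?expf_neq0 ?jn //.
  by rewrite valuation_exp ?jn // mb mulNr -mulr_natl natz.
have dv a : a != 0 -> m (j a) = (m (j a) %/ n)%Z * n%:Z.
  move=> a1; have n1 : n%:Z != 0 by rewrite -lt0n in n0 *.
  rewrite [LHS](divz_eq _ n); set q := (_ %/ _)%Z; set r := (_ %% _)%Z.
  have r0 : 0 <= r by rewrite modz_ge0.
  have rn : r < n by rewrite ltz_pmod.
  have hr : m (j (a * b ^ (- q))) = r.
    by rewrite hm // mulNr [m (j a)](divz_eq _ n) addrAC subrr add0r.
  suff -> : r = 0 by rewrite addr0.
  case rs : r => [s|s]; last by rewrite rs in r0.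
  case: s => // s in rs *; have /nmin : P s.+1.
    apply/asboolP; split=> //; exists (a * b ^ (- q)); last by rewrite hr rs.
    by rewrite mulf_neq0 ?expfz_neq0.
  by move: rn; rewrite rs ltz_nat ltnNge => /negPf->.
pose p a := (m (j a) %/ n)%Z.
have n1 : 0 < n%:Z by [].
have pE a : a != 0 -> m (j a) = p a * n%:Z by apply: dv.
have pM a a' : a != 0 -> a' != 0 -> p (a * a') = p a + p a'.
  move=> a1 a1'; apply: (mulIf (lt0r_neq0 n1)).
  by rewrite mulrDl -!pE ?mulf_neq0 // rmorphM valuationM ?jn.
have pD a a' : a != 0 -> a' != 0 -> a + a' != 0 -> Num.min (p a) (p a') <= p (a + a').
  move=> a1 a1' aa; have := valuationD m (jn _ a1) (jn _ a1').
  rewrite -rmorphD !pE // => /(_ (jn _ aa)).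
  by rewrite !ge_min !(ler_pM2r n1).
have p1 : exists2 a, a != 0 & p a = 1.
  by exists b => //; rewrite /p mb divzz gt_eqF.
by exists (Valuation pM pD p1), n%:Z; split.
Qed.

Lemma restriction_residue (E L : fieldType) (j : {rmorphism E -> L}) (m : valuation L)
    (p : valuation E) (c : int) :
  0 < c -> (forall a, a != 0 -> m (j a) = p a * c) ->
  (forall a, (j a \in val_ring m) = (a \in val_ring p)) /\
  exists e : {rmorphism residue_field p -> residue_field m},
    forall a, a \in val_ring p -> e (residue p a) = residue m (j a).
Proof.
move=> c0 mp.
have jV a : (j a \in val_ring m) = (a \in val_ring p).
  rewrite !val_ringE fmorph_eq0; have [//|a0] /= := eqVneq a 0.
  by rewrite mp // pmulr_lge0.
split=> //; apply: residue_lift => [|a b ha hb|a b ha hb|a ha].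
- by rewrite rmorph1 residue1.
- by rewrite rmorphD residueD ?jV.
- by rewrite rmorphM residueM ?jV.
move=> /eqP; have [->|a0] := eqVneq a 0; first by move=> _; rewrite rmorph0 residue0.
move: (ha); rewrite val_ringE (negPf a0) /= => pa; rewrite residue_eq0P // => pa0.
by apply/eqP; rewrite residue_eq0P ?fmorph_eq0 // mp ?pmulr_lge0 ?pmulr_lgt0.
Qed.

(** * Local rings of isomorphism pairs *)

(** O is the ring of the elements of K at which mu is finite.  [place_none] says
    that it is a valuation ring, possibly K itself.  O is a type because
    polynomials over it are needed. *)
Record place_ring (k K F : fieldType) (iK : k -> K) (mu : K -> option F)
    (O : comNzRingType) (val : O -> K) (nu : O -> F) (iO : k -> O) : Prop := PlaceRing {
  place_inj : injective val;
  place_some : forall o, mu (val o) = Some (nu o);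
  place_dom : forall a b, mu a = Some b -> exists o, val o = a;
  place_none : forall a, mu a = None -> exists o, val o = a^-1 /\ nu o = 0;
  place_const : forall c, val (iO c) = iK c }.

Lemma lift_constants (k K : fieldType) (O : comNzRingType) (val : {rmorphism O -> K})
    (iK : {rmorphism k -> K}) :
  injective val -> (forall c, exists o, val o = iK c) ->
  exists iO : {rmorphism k -> O}, forall c, val (iO c) = iK c.
Proof.
move=> inj /choice[f hf].
have fB : zmod_morphism f by move=> a b; apply: inj; rewrite rmorphB !hf rmorphB.
have fM : monoid_morphism f.
  by split=> [|a b]; apply: inj; rewrite ?rmorph1 ?rmorphM !hf ?rmorph1 ?rmorphM.
pose fr : {rmorphism k -> O} := HB.pack f
  (GRing.isZmodMorphism.Build _ _ f fB) (GRing.isMonoidMorphism.Build _ _ f fM).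
by exists fr.
Qed.

Lemma sepgen_function_field (k K : fieldType) (i : {rmorphism k -> K}) x u :
  separably_generated i x u -> function_field_in i x.
Proof.
move=> s; split; first exact: inj_transcendental (sepgen_transcendental s).
apply: fin_span_finite_over.
apply: fin_span_sub (fin_span_evp (sepgen_transcendental s) (sepgen_algebraic s)) => a _.
exact: sepgen_generated s a.
Qed.

(** Let y have value 1.  A polynomial relation between a and y, divided by the
    largest possible power of y, reduces modulo p to an equation over k for the
    residue of a. *)
Lemma residue_algebraic (k K : fieldType) (i : {rmorphism k -> K}) x (p : valuation K)
    (ip : {rmorphism k -> residue_field p}) a :
  function_field_in i x -> trivial_on i p -> (forall c, ip c = residue p (i c)) ->
  a \in val_ring p -> algebraicOver ip (residue p a).
Proof.
move=> hx tr hip ha; have [y y0 py] := valuation_normalized p.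
have yr : y \in val_ring p by rewrite val_ringE py orbT.
have ry : residue p y = 0 by apply/eqP; rewrite residue_eq0P ?py.
have hi c : i c \in val_ring p by apply: trivial_val_ring.
have hip' c : residue p (i c) = ip c by rewrite hip.
have strip q : evp i y q = 0 -> q = 0.
  move=> qy; apply/eqP/negPn/negP => q0.
  have [|s [C [hC [[] C0]]]] := strip_power_of_X (C := fun _ : unit => q); first by exists tt.
  move/eqP: qy; rewrite (hC tt) rmorphM rmorphXn /= evpX mulf_eq0 expf_eq0 (negPf y0).
  rewrite andbF orbF => /eqP Cy; have [_] := evp_residue (C tt) hi hip' yr.
  by rewrite Cy residue0 ry evp0 => /esym/eqP; rewrite fmorph_eq0 (negPf C0).
have inj : injective (evp i y) by apply: ker0_injective.
have [q q0 qa] := function_field_dependent a hx inj.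
have q'0 : swapXY q != 0 by rewrite swapXY_eq0.
have [|s [C [hC [[] C0]]]] := strip_power_of_X (C := fun _ : unit => swapXY q).
  by exists tt.
have Cy : evp (evp i a) y (C tt) = 0.
  have /eqP : evp (evp i a) y (swapXY q) = 0 by rewrite evp2_swap.
  rewrite (hC tt) rmorphM rmorphXn /= evpX mulf_eq0 expf_eq0 (negPf y0).
  by rewrite andbF orbF => /eqP.
exists (C tt)`_0 => //; apply/rootP.
have h1 r : evp i a r \in val_ring p by case: (evp_residue r hi hip' ha).
have h2 r : residue p (evp i a r) = evp ip (residue p a) r.
  by case: (evp_residue r hi hip' ha).
by have [_] := evp_residue (C tt) h1 h2 yr; rewrite Cy residue0 ry evp0 => /esym.
Qed.

Section Core.

Variables (k K K' D : fieldType).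
Variables (iK : {rmorphism k -> K}) (iK' : {rmorphism k -> K'}).
Variables (jK : {rmorphism K -> D}) (jK' : {rmorphism K' -> D}).
Variables (x u : K) (x' u' : K').
Hypothesis H : free_compositum iK iK' jK jK' x u x' u'.

Section Pair.

Variables (F : fieldType) (iF : {rmorphism k -> F}).
Variables (mu : K -> option F) (mu' : K' -> option F) (g' : {rmorphism K' -> F}).
Hypothesis pair : isomorphism_pair iK iK' iF mu mu'.
Hypothesis mu'E : forall a, mu' a = Some (g' a).

Lemma pair_ground' c : iF c = g' (iK' c).
Proof. by have := iso_pair_ground' pair c; rewrite mu'E => -[]. Qed.

Lemma pair_transcendental : ~ algebraicOver iF (g' x').
Proof.
move=> [p p0 /rootP px]; case/eqP: p0; apply: (sepgen_transcendental (fc_sepgen' H)).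
rewrite rmorph0; apply: (fmorph_inj g'); rewrite rmorph0 -px -evp_comp.
by apply: eq_evp => c /=; rewrite pair_ground'.
Qed.

(** The images of x and x' in F are algebraically dependent over k, and that of x
    is transcendental; so a relation between them, with x substituted, remains a
    non-trivial equation for x' over K. *)
Lemma embedding_algebraic (g : {rmorphism K -> F}) :
  (forall a, mu a = Some (g a)) -> algebraic_over g (g' x').
Proof.
move=> muE; have ground c : g (iK c) = iF c.
  by have := iso_pair_ground pair c; rewrite muE => -[].
have [y hy] := iso_pair_function_field pair.
have inj : injective (evp iF (g x)).
  apply: ker0_injective => p px; apply: (sepgen_transcendental (fc_sepgen H)).
  rewrite rmorph0; apply: (fmorph_inj g); rewrite rmorph0 -px -evp_comp.
  by apply: eq_evp => c /=; rewrite ground.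
have [q q0 qx] := function_field_dependent (g' x') hy inj.
exists (map_poly (evp iK x) q).
  exact: map_poly_neq0 (sepgen_transcendental (fc_sepgen H)) q0.
rewrite evp_map -qx; apply: eq_evp => p /=; rewrite -evp_comp.
by apply: eq_evp => c /=; rewrite ground.
Qed.

(** The residue field of p is algebraic over k, whereas x' is transcendental. *)
Lemma residue_transcendental (p : valuation K) (e : {rmorphism residue_field p -> F})
    (g : {poly val_ring_type p}) :
  trivial_on iK p -> (forall a, mu a = omap e (residue_class p a)) ->
  evp (e \o @residue_hom K p) (g' x') g = 0 -> map_poly (e \o @residue_hom K p) g = 0.
Proof.
move=> tr muE gx; apply/eqP/negPn/negP => g0; apply: pair_transcendental.
have [ip hip] := trivial_residue tr.
have eip c : e (ip c) = iF c.
  have := iso_pair_ground pair c; rewrite muE residue_classE trivial_val_ring //=.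
  by rewrite hip => -[].
apply/integral_algebraic; apply: integral_root g0 _ _; first exact/rootP.
move=> _ /(nthP 0)[j _ <-]; apply/integral_algebraic.
rewrite coef_map /=.
have [q q0 /rootP qa] := residue_algebraic (sepgen_function_field (fc_sepgen H)) tr hip (valP g`_j).
exists q => //; apply/rootP; rewrite -[RHS](rmorph0 e) -qa.
rewrite -[LHS]/(evp iF _ q) -[X in _ = e X]/(evp ip _ q) -evp_comp.
by apply: eq_evp => c /=; rewrite eip.
Qed.

(** The uniformizer in O[x'] has a different origin according to whether mu is an
    embedding or the residue map of a place. *)
Lemma pair_uniformized1 : exists (O : idomainType) (val : {rmorphism O -> K})
    (nu : {rmorphism O -> F}) (iO : {rmorphism k -> O}) (pi : {poly O}),
  place_ring iK mu val nu iO /\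
  uniformized (evp (jK \o val) (jK' x')) (evp nu (g' x')) pi.
Proof.
have injx := fc_transcendental' H.
have emb : isomorphism_into mu -> exists (O : idomainType) (val : {rmorphism O -> K})
    (nu : {rmorphism O -> F}) (iO : {rmorphism k -> O}) (pi : {poly O}),
  place_ring iK mu val nu iO /\
  uniformized (evp (jK \o val) (jK' x')) (evp nu (g' x')) pi.
  move=> [g muE]; have [||h hh] := @unif_algebraic K D F (jK \o idfun) g (jK' x') (g' x').
  - by move=> a b; rewrite !(@eq_evp _ _ (jK \o idfun) jK) //; apply: injx.
  - exact: embedding_algebraic.
  exists K, idfun, g, iK, h; split=> //; split=> //= [a b _|a]; first by exists a.
  by rewrite muE.
case: (iso_pair_kind pair) => [[/emb//]||[/emb//]].
move=> [[p [e [tr muE]]] _].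
pose val : {rmorphism val_ring_type p -> K} := [the {rmorphism _ -> _} of \val].
have injv : injective val by apply: val_inj.
have constP c : exists o : val_ring_type p, val o = iK c.
  by exists (ValRing (trivial_val_ring c tr)).
have [iO hO] := lift_constants injv constP.
have [pi U] := unif_val_ring jK e.
exists (val_ring_type p), val, (e \o @residue_hom K p), iO, pi%:P; split.
  split=> //.
  - by move=> o; rewrite muE residue_classE (valP o).
  - move=> a b; rewrite muE residue_classE; case: ifP => // ha _.
    by exists (ValRing ha).
  move=> a; rewrite muE residue_classE; case: ifPn => // /val_ring_inverse[a0 aV ra] _.
  by exists (ValRing aV); split=> //=; rewrite /residue_hom /= ra rmorph0.
apply: unif_transcendental => //.
  move=> a b h; apply: (map_inj_poly injv (rmorph0 _)); apply: injx.
  by rewrite !evp_map.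
by move=> g; apply: residue_transcendental.
Qed.

(** The step from O[x'] to O[x', u'].  The last clause expresses the elements of K'
    as fractions of polynomials in x' and u' over k, with denominators outside the
    kernel. *)
Lemma pair_uniformized : exists (O : idomainType) (val : {rmorphism O -> K})
    (nu : {rmorphism O -> F}) (iO : {rmorphism k -> O}) (pi : {poly {poly O}}),
  let ev := evp (evp (jK \o val) (jK' x')) (jK' u') in
  let phi := evp (evp nu (g' x')) (g' u') in
  [/\ place_ring iK mu val nu iO, uniformized ev phi pi,
      forall y, y \in fracp ev
    & forall b, exists p q, [/\ phi q != 0, jK' b = ev p / ev q & g' b = phi p / phi q]].
Proof.
have [O [val [nu [iO [pi [pl U]]]]]] := pair_uniformized1.
have nuE c : nu (iO c) = g' (iK' c).
  have := place_some pl (iO c); rewrite (place_const pl) (iso_pair_ground pair).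
  by rewrite pair_ground' => -[].
have valE c : jK (val (iO c)) = jK' (iK' c).
  by rewrite (place_const pl); exact: (fc_ground H c).
exists O, val, nu, iO, pi%:P => ev phi.
have ev_lift g : ev (map_poly (map_poly iO) g) = jK' (evp (evp iK' x') u' g).
  rewrite /ev evp_map -evp_comp; apply: eq_evp => q /=.
  by rewrite evp_map -evp_comp; apply: eq_evp => c /=; apply: valE.
have phi_lift g : phi (map_poly (map_poly iO) g) = g' (evp (evp iK' x') u' g).
  rewrite /phi evp_map -evp_comp; apply: eq_evp => q /=.
  by rewrite evp_map -evp_comp; apply: eq_evp => c /=; apply: nuE.
have jK'_frac b : exists p q,
    [/\ phi q != 0, jK' b = ev p / ev q & g' b = phi p / phi q].
  have /fracP[p [q [q0 ->]]] := sepgen_generated (fc_sepgen' H) b.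
  exists (map_poly (map_poly iO) p), (map_poly (map_poly iO) q).
  by rewrite !ev_lift !phi_lift !fmorph_div fmorph_eq0.
have injev : injective (evp (jK \o val) (jK' x')).
  move=> a b h; apply: (map_inj_poly (place_inj pl) (rmorph0 _)).
  by apply: (fc_transcendental' H); rewrite !evp_map.
have wd g : ev g = 0 -> phi g = 0.
  apply: (fc_well_defined H (place_inj pl)) => c; exists (iO c) => //.
  exact: place_const pl c.
split=> //.
- have [f [fu f'u]] := sepgen_separable (fc_sepgen' H).
  apply: (unif_simple_root (f := map_poly (map_poly iO) f) injev U) => //.
  + by rewrite -[LHS]/(ev _) ev_lift fu rmorph0.
  + by rewrite -[LHS]/(phi _) phi_lift fu rmorph0.
  by rewrite deriv_map -[X in X != 0]/(phi _) phi_lift fmorph_eq0.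
apply: (fc_generated H) => [|a|b]; first exact: fracp_divring.
- have evC o : jK (val o) \in fracp ev.
    by have := frac_ev ev o%:P%:P; rewrite /ev /= evpC /= evpC.
  case E : (mu a) => [b|]; first by have [o <-] := place_dom pl E.
  have [o [e _]] := place_none pl E.
  by rewrite -[a]invrK fmorphV rpredV -e.
have [p [q [_ -> _]]] := jK'_frac b.
by rewrite rpred_div ?frac_ev.
Qed.

(** The valuation w of the localization induces the given pair: the quotient
    ev p / ev q has residue phi p / phi q.  The type T stands for the ring of
    polynomials in x' and u' over O. *)
Lemma localization_valuation (O : idomainType) (val : {rmorphism O -> K})
    (nu : {rmorphism O -> F}) (iO : {rmorphism k -> O}) (T : comNzRingType)
    (ev : {rmorphism T -> D}) (phi : {rmorphism T -> F}) (pi : T) (cst : O -> T) :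
  place_ring iK mu val nu iO -> uniformized ev phi pi ->
  (forall o, ev (cst o) = jK (val o)) -> (forall o, phi (cst o) = nu o) ->
  (forall y, y \in fracp ev) ->
  (forall b, exists p q, [/\ phi q != 0, jK' b = ev p / ev q & g' b = phi p / phi q]) ->
  exists w : valuation D,
  trivial_on jK' w /\ exists e : {rmorphism residue_field w -> F},
    (forall a, mu a = omap e (induced jK w a)) /\
    (forall b, mu' b = omap e (induced jK' w b)).
Proof.
move=> pl U ev_cst phi_cst fr jK'_frac.
have [w hw] := uniformized_valuation U fr.
have evu a : phi a != 0 -> ev a != 0 by apply: (unif_ev_neq0 U).
have trw : trivial_on jK' w.
  move=> b b0; have [p [q [q0 e1 e2]]] := jK'_frac b.
  have p0 : phi p != 0.
    apply: contraNneq b0 => p0; move/eqP: e2; by rewrite p0 mul0r fmorph_eq0.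
  have : jK' b \in val_ring w by rewrite hw e1; apply: localp_unit.
  have : (jK' b)^-1 \in val_ring w by rewrite hw e1 invf_div; apply: localp_unit.
  have jb : jK' b != 0 by rewrite fmorph_eq0.
  rewrite !val_ringE invr_eq0 (negPf jb) /= valuationV // oppr_ge0 => h1 h2.
  by apply/eqP; rewrite eq_le h1 h2.
(* the graph of the residue map *)
pose G y z := exists p q, [/\ phi q != 0, y = ev p / ev q & z = phi p / phi q].
have Gfun y z z' : G y z -> G y z' -> z = z'.
  move=> [p [q [q0 -> ->]]] [p' [q' [q'0 /eqP h ->]]]; apply/eqP.
  rewrite eqr_div ?evu // -!rmorphM -subr_eq0 -rmorphB in h.
  rewrite eqr_div // -!rmorphM -subr_eq0 -rmorphB; apply/eqP.
  by apply: (unif_ker U); apply/eqP.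
have Gtot y : y \in val_ring w -> exists z, G y z.
  by rewrite hw => /localP[p [q [q0 ->]]]; exists (phi p / phi q), p, q.
have /choice[psi hpsi] y : exists z, y \in val_ring w -> G y z.
  by have [/Gtot[z hz]|_] := boolP (y \in val_ring w); [exists z | exists 0].
have psiE y z : y \in val_ring w -> G y z -> psi y = z.
  by move=> hy; apply: Gfun; apply: hpsi.
have [|a b ha hb|a b ha hb|a ha ra|e he] := @residue_lift _ w F psi.
- apply: psiE; first exact: rpred1.
  by exists 1, 1; rewrite !rmorph1 !divr1 oner_neq0.
- have [p [q [q0 e1 ->]]] := hpsi a ha; have [p' [q' [q'0 e1' ->]]] := hpsi b hb.
  apply: psiE; first exact: rpredD.
  exists (p * q' + p' * q), (q * q'); rewrite !rmorphD !rmorphM mulf_neq0 //.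
  by rewrite e1 e1' !addf_div // evu.
- have [p [q [q0 e1 ->]]] := hpsi a ha; have [p' [q' [q'0 e1' ->]]] := hpsi b hb.
  apply: psiE; first exact: rpredM.
  by exists (p * p'), (q * q'); rewrite !rmorphM mulf_neq0 // e1 e1' !mulf_div.
- have [p [q [q0 e1 ->]]] := hpsi a ha.
  have [->|p0] := eqVneq (phi p) 0; first by rewrite mul0r.
  have a0 : a != 0 by rewrite e1 mulf_neq0 ?invr_eq0 ?evu.
  have : a^-1 \in val_ring w by rewrite hw e1 invf_div; apply: localp_unit.
  move: (ha) ra; rewrite !val_ringE invr_eq0 (negPf a0) /= => wa /eqP.
  by rewrite residue_eq0P // valuationV // oppr_ge0 leNgt => ->.
have evC o : G (jK (val o)) (nu o).
  by exists (cst o), 1; rewrite !rmorph1 oner_neq0 !divr1 ev_cst phi_cst.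
have GV y z : G y z -> y \in val_ring w.
  by move=> [p [q [q0 -> _]]]; rewrite hw; apply/localP; exists p, q.
have eG y z : G y z -> e (residue w y) = z.
  by move=> h; rewrite he ?(GV _ _ h) //; exact: psiE (GV _ _ h) h.
exists w; split=> //; exists e; split=> [a|b]; rewrite /induced residue_classE; last first.
  have hb : G (jK' b) (g' b) by apply: jK'_frac.
  by rewrite (GV _ _ hb) mu'E /= (eG _ _ hb).
case E : (mu a) => [b|].
  have [o ao] := place_dom pl E; move: E; rewrite -ao (place_some pl) => -[<-].
  by rewrite (GV _ _ (evC o)) /= (eG _ _ (evC o)).
have [o [oa no]] := place_none pl E; case: ifP => // /Gtot[z hz].
have a0 : a != 0.
  apply/eqP => a0; have := place_some pl 0; rewrite rmorph0 -a0 E //.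
case: hz => [p [q [q0 e1 _]]].
have : ev (cst o * p - q) = 0.
  apply/eqP; rewrite rmorphB rmorphM subr_eq0 /= ev_cst oa fmorphV; apply/eqP.
  apply: (mulfI (_ : jK a != 0)); first by rewrite fmorph_eq0.
  by rewrite mulrA divff ?fmorph_eq0 // mul1r e1 divfK ?evu.
move=> /(unif_ker U)/eqP; rewrite rmorphB rmorphM /= phi_cst no mul0r sub0r.
by rewrite oppr_eq0 (negPf q0).
Qed.

Lemma pair_valuation : exists w : valuation D,
  trivial_on jK' w /\ exists e : {rmorphism residue_field w -> F},
    (forall a, mu a = omap e (induced jK w a)) /\
    (forall b, mu' b = omap e (induced jK' w b)).
Proof.
have [O [val [nu [iO [pi [pl U fr jK'_frac]]]]]] := pair_uniformized.
apply: (localization_valuation (cst := fun o : O => o%:P%:P) pl U) => // o.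
  by rewrite /= evpC /= evpC.
by rewrite /= evpC /= evpC.
Qed.

End Pair.
End Core.

(** * Classes of pairs and prime divisors *)

Lemma generated_divring (L : fieldType) (A : L -> Prop) :
  divring_closed (fun b => `[< generated A b >] : bool).
Proof.
split.
- by apply/asboolP => P [h1 _ _] _.
- move=> a b /asboolP ha /asboolP hb; apply/asboolP => P hP hA.
  by case: (hP) => _ hB _; apply: hB; [apply: ha | apply: hb].
move=> a b /asboolP ha /asboolP hb; apply/asboolP => P hP hA.
by case: (hP) => _ _ hD; apply: hD; [apply: ha | apply: hb].
Qed.

Lemma composite_sym (K K' F : fieldType) (mu : K -> option F) (mu' : K' -> option F) b :
  composite mu mu' b -> composite mu' mu b.
Proof. by move=> h P hP hA; apply: h => // a [h|h]; apply: hA; [right | left]. Qed.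

Lemma same_class_sym (K K' F F1 : fieldType)
    (mu : K -> option F) (mu' : K' -> option F) (mu1 : K -> option F1) (mu1' : K' -> option F1) :
  same_class mu mu' mu1 mu1' -> same_class mu' mu mu1' mu1.
Proof.
move=> [s [[s1 sD sM sI sC sO] h h']]; exists s; split=> //.
have C := @composite_sym _ _ _ mu' mu.
split=> // [a b /C ha /C hb|a b /C ha /C hb|a b /C ha /C hb|a /C/sC/composite_sym //|b].
- exact: sD.
- exact: sM.
- exact: sI.
by move=> /composite_sym/sO[a /composite_sym]; exists a.
Qed.

(** An isomorphism of composites is only required on the composites; any embedding
    of the ambient fields that is compatible with the pairs restricts to one. *)
Lemma embedding_same_class (K K' F F1 : fieldType) (e : {rmorphism F -> F1})
    (mu : K -> option F) (mu' : K' -> option F) (mu1 : K -> option F1) (mu1' : K' -> option F1) :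
  (forall a, mu1 a = omap e (mu a)) -> (forall b, mu1' b = omap e (mu' b)) ->
  same_class mu mu' mu1 mu1'.
Proof.
move=> h h'; exists e; split=> //.
split=> [|a b _ _|a b _ _|a b _ _|a ha|b hb].
- exact: rmorph1.
- exact: rmorphD.
- exact: rmorphM.
- exact: fmorph_inj.
- pose P a := `[< composite mu1 mu1' (e a) >].
  have [P1 PB PD] := generated_divring
    (fun b => (exists a, mu1 a = Some b) \/ (exists a, mu1' a = Some b)).
  suff : a \in (P : {pred F}) by move/asboolP.
  apply: ha => [|c [[d hd]|[d hd]]].
  + split; first by rewrite /P /in_mem /= rmorph1.
      by move=> c d; rewrite /P /in_mem /= rmorphB; apply: PB.
    by move=> c d; rewrite /P /in_mem /= fmorph_div; apply: PD.
  + by apply/asboolP => Q hQ hA; apply: hA; left; exists d; rewrite h hd.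
  by apply/asboolP => Q hQ hA; apply: hA; right; exists d; rewrite h' hd.
pose P b := `[< exists2 a, composite mu mu' a & e a = b >].
have [/asboolP C1 CB CD] := generated_divring
  (fun b => (exists a, mu a = Some b) \/ (exists a, mu' a = Some b)).
suff : b \in (P : {pred F1}) by move/asboolP.
apply: hb => [|c [[d]|[d]]].
- split; first by apply/asboolP; exists 1; rewrite ?rmorph1.
    move=> _ _ /asboolP[c hc <-] /asboolP[d hd <-]; apply/asboolP; exists (c - d).
      by apply/asboolP; apply: CB; apply/asboolP.
    by rewrite rmorphB.
  move=> _ _ /asboolP[c hc <-] /asboolP[d hd <-]; apply/asboolP; exists (c / d).
    by apply/asboolP; apply: CD; apply/asboolP.
  by rewrite fmorph_div.
- rewrite h; case E : (mu d) => [c'|//] [<-]; apply/asboolP; exists c' => //.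
  by move=> Q hQ hA; apply: hA; left; exists d.
rewrite h'; case E : (mu' d) => [c'|//] [<-]; apply/asboolP; exists c' => //.
by move=> Q hQ hA; apply: hA; right; exists d.
Qed.

Lemma eqv_same_class (K K' D : fieldType) (jK : {rmorphism K -> D}) (jK' : {rmorphism K' -> D})
    (m n : valuation D) :
  eqv_valuation m n ->
  same_class (induced jK m) (induced jK' m) (induced jK n) (induced jK' n).
Proof.
move=> mn; have V a : (a \in val_ring n) = (a \in val_ring m).
  by rewrite !val_ringE; have [//|a0] := eqVneq a 0; rewrite mn.
have [|a b ha hb|a b ha hb|a ha|e he] := @residue_lift _ m (residue_field n) (residue n).
- exact: residue1.
- by rewrite residueD ?V.
- by rewrite residueM ?V.
- by move=> /eqP; rewrite residue_eq0 // => h; apply/eqP;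
     rewrite residue_eq0 ?V //; move: h; have [//|a0] := eqVneq a 0; rewrite mn.
have E a : residue_class n a = omap e (residue_class m a).
  by rewrite !residue_classE V; case: ifP => //= ha; rewrite he.
by apply: (embedding_same_class (e := e)) => a; apply: E.
Qed.

Section PrimeDivisors.

Variables (k K K' D : fieldType).
Variables (iK : {rmorphism k -> K}) (iK' : {rmorphism k -> K'}).
Variables (jK : {rmorphism K -> D}) (jK' : {rmorphism K' -> D}).
Variables (x u : K) (x' u' : K').
Hypothesis H : free_compositum iK iK' jK jK' x u x' u'.

Section Given.

Variable m : valuation D.
Hypothesis tr : trivial_on jK' m.

(** The restriction of m to K is trivial or a multiple of a place p of K, and the
    residue field of p embeds into that of m. *)
Lemma induced_pair : exists (iF : {rmorphism k -> residue_field m})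
    (g' : {rmorphism K' -> residue_field m}),
  isomorphism_pair iK iK' iF (induced jK m) (induced jK' m) /\
  forall b, induced jK' m b = Some (g' b).
Proof.
have [iF [hF ff]] := residue_function_field H tr.
have [g' hg'] := trivial_residue tr.
have mu'E b : induced jK' m b = Some (g' b).
  by rewrite /induced residue_classE trivial_val_ring // hg'.
have groundE c : jK (iK c) = jK' (iK' c) by exact: (fc_ground H c).
exists iF, g'; split=> //; split.
- by exists (residue m (jK' x')).
- by move=> c; rewrite /induced residue_classE groundE trivial_val_ring // hF.
- by move=> c; rewrite mu'E hg' hF.
have emb' : isomorphism_into (induced jK' m) by exists g'.
have [trK|ntr] := pselect (trivial_on jK m).
  have [g hg] := trivial_residue trK; apply: Or31; split=> //; exists g => a.
  by rewrite /induced residue_classE trivial_val_ring // hg.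
have [p [c [c0 mp]]] := valuation_restriction ntr.
have [pV [e he]] := restriction_residue c0 mp.
apply: Or32; split=> //; exists p, e; split=> [a a0|a].
  have := mp (iK a); rewrite fmorph_eq0 groundE tr ?fmorph_eq0 // => /(_ a0)/esym/eqP.
  by rewrite mulf_eq0 (gt_eqF c0) orbF => /eqP.
by rewrite /induced !residue_classE pV; case: ifP => //= ha; rewrite he.
Qed.

(** The ring of m is the localization attached to the pair that m induces; its
    elements and their residues are thus expressed through K and K'. *)
Lemma prime_divisor_local : exists (O : idomainType) (val : {rmorphism O -> K})
    (nu : {rmorphism O -> residue_field m}) (g' : {rmorphism K' -> residue_field m}),
  let ev := evp (evp (jK \o val) (jK' x')) (jK' u') in
  let phi := evp (evp nu (g' x')) (g' u') in
  [/\ forall o, induced jK m (val o) = Some (nu o),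
      forall b, induced jK' m b = Some (g' b),
      forall p, ev p \in val_ring m /\ residue m (ev p) = phi p
    & forall y, y \in val_ring m -> exists p q, phi q != 0 /\ y = ev p / ev q].
Proof.
have [iF [g' [pair mu'E]]] := induced_pair.
have [O [val [nu [iO [pi [pl U fr _]]]]]] := pair_uniformized H pair mu'E.
exists O, val, nu, g' => ev phi.
have g'E b : g' b = residue m (jK' b).
  by have := mu'E b; rewrite /induced residue_classE trivial_val_ring // => -[].
have nuE o : jK (val o) \in val_ring m /\ residue m (jK (val o)) = nu o.
  have := place_some pl o; rewrite /induced residue_classE.
  by case: ifP => // h [].
have h1 p : evp (jK \o val) (jK' x') p \in val_ring m /\
    residue m (evp (jK \o val) (jK' x') p) = evp nu (g' x') p.
  rewrite g'E; apply: evp_residue; last exact: trivial_val_ring.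
    by move=> o; case: (nuE o).
  by move=> o; case: (nuE o).
have h2 p : ev p \in val_ring m /\ residue m (ev p) = phi p.
  rewrite /phi [g' u']g'E; apply: evp_residue; last exact: trivial_val_ring.
    by move=> q; case: (h1 q).
  by move=> q; case: (h1 q).
split=> //; first exact: place_some pl.
have R := uniformized_val_ring U fr; move=> y.
rewrite R; [by move/localP | by move=> p; case: (h2 p) | move=> p p0].
by have [pV rp] := h2 p; apply: residue_unit => //; rewrite rp.
Qed.

Lemma induced_composite b : composite (induced jK m) (induced jK' m) b.
Proof.
have [O [val [nu [g' [nuE g'E resE R]]]]] := prime_divisor_local.
have [y hy <-] := residue_surj b; have [p [q [q0 yE]]] := R y hy.
move=> P hP hA; pose PS : divringClosed _ := HB.pack P (GRing.isDivringClosed.Build _ P hP).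
have hnu o : nu o \in (PS : {pred _}) by apply: hA; left; exists (val o).
have hg b' : g' b' \in (PS : {pred _}) by apply: hA; right; exists b'.
have h1 r : evp nu (g' x') r \in (PS : {pred _}).
  by rewrite (evp_sum _ _ (leqnn _)) rpred_sum // => j _; rewrite rpredM ?rpredX.
have h2 r : evp (evp nu (g' x')) (g' u') r \in (PS : {pred _}).
  by rewrite (evp_sum _ _ (leqnn _)) rpred_sum // => j _; rewrite rpredM ?rpredX //; exact: h1.
have [pV rp] := resE p; have [qV rq] := resE q.
have -> : residue m y = evp (evp nu (g' x')) (g' u') p / evp (evp nu (g' x')) (g' u') q.
  apply: (canRL (mulfK q0)); rewrite -rp -rq -residueM // yE divfK //.
  by apply: contraNneq q0 => e; rewrite -rq e residue0.
exact: (rpred_div (h2 p) (h2 q)).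
Qed.

(** An isomorphism s between the pairs of m and n carries the residue of a
    polynomial expression in O and K' modulo m to its residue modulo n.  Hence
    the fractions that make up the ring of m are also integral for n. *)
Lemma same_class_eqv (n : valuation D) :
  same_class (induced jK m) (induced jK' m) (induced jK n) (induced jK' n) ->
  eqv_valuation m n.
Proof.
move=> [s [[s1 sD sM sI _ _] hK hK']]; apply: val_ring_eqv => y.
have C := induced_composite.
have s0 : s 0 = 0.
  by apply: (addrI (s 0)); rewrite -sD // !addr0.
have [O [val [nu [g' [nuE g'E resE R]]]]] := prime_divisor_local.
pose Q y z := y \in val_ring n /\ residue n y = s z.
have QD a b c d : Q a c -> Q b d -> Q (a + b) (c + d).
  by move=> [ha ra] [hb rb]; rewrite /Q rpredD // residueD // ra rb sD.
have QM a b c d : Q a c -> Q b d -> Q (a * b) (c * d).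
  by move=> [ha ra] [hb rb]; rewrite /Q rpredM // residueM // ra rb sM.
have Qnu o : Q (jK (val o)) (nu o).
  have := hK (val o); rewrite nuE /induced residue_classE /=.
  by case: ifP => // h [].
have Qg b : Q (jK' b) (g' b).
  have := hK' b; rewrite g'E /induced residue_classE /=.
  by case: ifP => // h [].
have Q1 p : Q (evp (jK \o val) (jK' x') p) (evp nu (g' x') p) by apply: evp_rel.
have Q2 p : Q (evp (evp (jK \o val) (jK' x')) (jK' u') p)
    (evp (evp nu (g' x')) (g' u') p) by apply: evp_rel.
move=> /R[p [q [q0 ->]]]; have [pV _] := Q2 p; have [qV rq] := Q2 q.
rewrite rpredM // residue_unit // rq; apply: contraNneq q0 => e.
by apply/eqP; apply: sI => //; rewrite s0.
Qed.

End Given.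

Lemma pair_prime_divisor (F : fieldType) (iF : {rmorphism k -> F})
    (mu : K -> option F) (mu' : K' -> option F) :
  isomorphism_pair iK iK' iF mu mu' -> isomorphism_into mu' ->
  exists2 w : valuation D, trivial_on jK' w &
    same_class (induced jK w) (induced jK' w) mu mu'.
Proof.
move=> pair [g' mu'E]; have [w [trw [e [h h']]]] := pair_valuation H pair mu'E.
by exists w => //; apply: (embedding_same_class h h').
Qed.

End PrimeDivisors.

Lemma isomorphism_pair_sym (k K K' F : fieldType)
    (iK : {rmorphism k -> K}) (iK' : {rmorphism k -> K'}) (iF : {rmorphism k -> F})
    (mu : K -> option F) (mu' : K' -> option F) :
  isomorphism_pair iK iK' iF mu mu' -> isomorphism_pair iK' iK iF mu' mu.
Proof.
case=> ff gr gr' kd; split=> //.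
by case: kd => -[h h']; [apply: Or31 | apply: Or33 | apply: Or32]; split.
Qed.

(** The valuations of D are non-trivial by normalization, so the three kinds cover
    exactly those that are trivial on one of the two fields. *)
Lemma in_S_trivial (K K' D : fieldType) (jK : {rmorphism K -> D}) (jK' : {rmorphism K' -> D})
    (m : valuation D) :
  in_S jK jK' m <-> trivial_on jK' m \/ trivial_on jK m.
Proof.
split=> [[[_ t]|[t _]|[t _]]|t]; [by left | by left | by right |].
have [tK|tK] := pselect (trivial_on jK m); have [tK'|tK'] := pselect (trivial_on jK' m).
- by apply: Or31.
- by apply: Or33.
- by apply: Or32.
- by case: t.
Qed.

Lemma double_field_free_compositum (k : fieldExtType rat) (K K' D : fieldType)
    (iK : {rmorphism k -> K}) (iK' : {rmorphism k -> K'})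
    (x u : K) (x' u' : K') (f f' : {poly {poly k}})
    (jK : {rmorphism K -> D}) (jK' : {rmorphism K' -> D}) :
  function_field_in iK x -> function_field_in iK' x' ->
  generating_poly iK x u f -> generating_poly iK' x' u' f' ->
  double_field iK iK' jK jK' x u x' u' f' ->
  free_compositum iK iK' jK jK' x u x' u'.
Proof.
move=> hx hx' gf gf' [gr indep gen irr].
have sK := generating_sepgen hx gf; have sK' := generating_sepgen hx' gf'.
have f'u : evp (evp iK' x') u' f' = 0 by rewrite -eval_xuE; case: gf'.
split=> //; first exact: (irreducible_lindisj gr sK sK' indep f'u irr).
move=> P hP h h' y; apply: adjoin_sub (gen y) => // [c|z]; first exact: h.
by rewrite !inE => /or4P[] /eqP->.
Qed.

Theorem theorem2p1
    (k : fieldExtType rat) (K K' D : fieldType)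
    (iK : {rmorphism k -> K}) (iK' : {rmorphism k -> K'})
    (x u : K) (x' u' : K') (f f' : {poly {poly k}})
    (jK : {rmorphism K -> D}) (jK' : {rmorphism K' -> D}) :
  function_field_in iK x -> function_field_in iK' x' ->
  generating_poly iK x u f -> generating_poly iK' x' u' f' ->
  double_field iK iK' jK jK' x u x' u' f' ->
  [/\ (* every prime divisor m in S induces an isomorphism pair into the residue
         field D m, and D m is the composite of its two images *)
      forall m : valuation D, in_S jK jK' m ->
        (exists iF : {rmorphism k -> residue_field m},
          isomorphism_pair iK iK' iF (induced jK m) (induced jK' m)) /\
        (forall b, composite (induced jK m) (induced jK' m) b),
      (* the resulting map from S to classes is well defined and injective *)
      forall m n : valuation D, in_S jK jK' m -> in_S jK jK' n ->
        (same_class (induced jK m) (induced jK' m)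
                    (induced jK n) (induced jK' n) <-> eqv_valuation m n)
    & (* and surjective *)
      forall (F : fieldType) (iF : {rmorphism k -> F})
             (mu : K -> option F) (mu' : K' -> option F),
        isomorphism_pair iK iK' iF mu mu' ->
        exists2 m : valuation D, in_S jK jK' m &
          same_class (induced jK m) (induced jK' m) mu mu'].
Proof.
move=> hx hx' gf gf' df.
have H := double_field_free_compositum hx hx' gf gf' df.
have H' := free_compositum_sym H.
split.
- move=> m /in_S_trivial[tr|tr]; split.
  + by have [iF [g' [pair _]]] := induced_pair H tr; exists iF.
  + by move=> b; apply: (induced_composite H tr).
  + have [iF [g' [pair _]]] := induced_pair H' tr.
    by exists iF; apply: isomorphism_pair_sym.
  + by move=> b; apply/composite_sym/(induced_composite H' tr).
- move=> m n mS _; split; last exact: eqv_same_class.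
  move: mS => /in_S_trivial[tr|tr] sc; first exact: (same_class_eqv H tr sc).
  exact: (same_class_eqv H' tr (same_class_sym sc)).
move=> F iF mu mu' pair.
have [emb'|emb] : isomorphism_into mu' \/ isomorphism_into mu.
- by case: (iso_pair_kind pair) => -[h h']; [left | left | right].
- have [w trw sc] := pair_prime_divisor H pair emb'; exists w => //.
  by apply/in_S_trivial; left.
have [w trw sc] := pair_prime_divisor H' (isomorphism_pair_sym pair) emb.
exists w; first by apply/in_S_trivial; right.
exact: same_class_sym.
Qed.
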